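(* Given a Vogan diagram of classical type having at least two painted nodes, any $\varphi$ belonging to the associated dominant Weyl chamber $C$ (and such that $v=ih_\varphi$ has compact stabilizer, so that its orbit carries the canonical almost complex structure) is not integrable.
   Context: A Vogan diagram here means a Dynkin diagram with some painted vertices (trivial automorphism); it is of classical type if the underlying Dynkin diagram is of type $A_\ell$, $B_\ell$, $C_\ell$ or $D_\ell$. It determines a real semisimple Lie algebra $\mathfrak g$ with Cartan decomposition $\mathfrak g=\mathfrak k\oplus\mathfrak p$, a maximal abelian subalgebra $\mathfrak h_0\subset\mathfrak k$ whose complexification is a Cartan subalgebra of $\mathfrak g_c=\mathfrak g\otimes\mathbf C$, a root system $\Delta$ and a positive system $\Delta^+$ with simple roots $\gamma_1,\dots,\gamma_\ell$ corresponding to the nodes, such that $\gamma_i$ is non-compact exactly when its node is painted. A root $\alpha$ is compact ($\varepsilon_\alpha=-1$) if its root space $\mathfrak g^\alpha$ lies in $\mathfrak k_c$, non-compact ($\varepsilon_\alpha=1$) if it lies in $\mathfrak p_c$. Let $B$ be the Killing form, positive definite on $\mathfrak h_{\mathbf R}=i\mathfrak h_0$; for $\psi\in\mathfrak h_{\mathbf R}^*$, $h_\psi$ satisfies $\psi(h)=B(h_\psi,h)$ on $\mathfrak h_{\mathbf R}$, and $(\psi,\psi')=B(h_\psi,h_{\psi'})$. $C=\{\psi\in\mathfrak h_{\mathbf R}^*:(\psi,\alpha)\ge0\ \forall\alpha\in\Delta^+\}$. Let $G$ be a Lie group with Lie algebra $\mathfrak g$. For $\varphi\in C$ such that $v=ih_\varphi$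 has compact stabilizer $V\subset G$ under the adjoint action, identify $T_e(G/V)$ with the $B$-orthogonal complement $\mathfrak m$ of the Lie algebra of $V$. One has $\mathfrak m=\bigoplus\mathfrak m_\alpha$ over $\alpha\in\Delta^+$ with $(\varphi,\alpha)\ne0$, $\mathfrak m_\alpha=(\mathfrak g^\alpha\oplus\mathfrak g^{-\alpha})\cap\mathfrak g$, and the canonical $G$-invariant almost complex structure $J$ on $G/V$ acts on $\mathfrak m_\alpha$ by $x\mapsto\frac{\varepsilon_\alpha}{(\varphi,\alpha)}[v,x]$. $\varphi$ is called integrable if $J$ is integrable (its Nijenhuis tensor vanishes). *)

(* Defs.v *)
From HB Require Import structures.
From mathcomp Require Import all_boot all_order all_algebra.
From mathcomp Require Import complex.
From mathcomp Require Import all_classical all_reals all_analysis.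

Set Implicit Arguments.
Unset Strict Implicit.
Unset Printing Implicit Defensive.

Import Order.TTheory GRing.Theory Num.Theory.
Import numFieldNormedType.Exports.

Local Open Scope classical_set_scope.
Local Open Scope ring_scope.

(* A Lie algebra of dimension n over F is F^n (row vectors) together with a
   bracket br; every finite-dimensional Lie algebra is of this form after a
   choice of basis. *)
Section LieAlgebra.
Context {F : fieldType} {n : nat}.
Implicit Types (br : 'rV[F]_n -> 'rV[F]_n -> 'rV[F]_n) (U V : {vspace 'rV[F]_n}).

Definition lie_bracket br : Prop :=
  [/\ forall (a : F) x y z, br (a *: x + y) z = a *: br x z + br y z,
      forall (a : F) x y z, br z (a *: x + y) = a *: br z x + br z y,
      forall x, br x x = 0 &
      forall x y z, br x (br y z) + br y (br z x) + br z (br x y) = 0].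

Definition killing br (x y : 'rV[F]_n) : F :=
  \tr (lin1_mx (fun z => br x (br y z))).

Definition commutatorv br U V : {vspace 'rV[F]_n} :=
  <<[seq br x y | x <- vbasis U, y <- vbasis V]>>%VS.

Definition lie_subalgebra br U := (commutatorv br U U <= U)%VS.
Definition lie_ideal br U := (commutatorv br fullv U <= U)%VS.
Definition lie_abelian br U := commutatorv br U U == 0%VS.

Definition lie_solvable br U : Prop :=
  exists k, iter k (fun V => commutatorv br V V) U = 0%VS.

Definition lie_nilpotent br U : Prop :=
  exists k, iter k (commutatorv br U) U = 0%VS.

Definition lie_semisimple br : Prop :=
  forall U, lie_ideal br U -> lie_solvable br U -> U = 0%VS.

Definition cartan_subalgebra br U : Prop :=
  [/\ lie_subalgebra br U, lie_nilpotent br U &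
      forall x, (forall y, y \in U -> br x y \in U) -> x \in U].

End LieAlgebra.

(* The complexification of R^n is R[i]^n. *)
Section Complexification.
Context {R : realType} {n : nat}.

Definition cplx (x : 'rV[R]_n) : 'rV[R[i]]_n := map_mx (real_complex R) x.

Definition cplxv (U : {vspace 'rV[R]_n}) : {vspace 'rV[R[i]]_n} :=
  <<map cplx (vbasis U)>>%VS.

Definition cplx_br (br : 'rV[R]_n -> 'rV[R]_n -> 'rV[R]_n)
    (z w : 'rV[R[i]]_n) : 'rV[R[i]]_n :=
  let re := map_mx (@complex.Re R) in let im := map_mx (@complex.Im R) in
  cplx (br (re z) (re w) - br (im z) (im w)) +
  'i%C *: cplx (br (re z) (im w) + br (im z) (re w)).

End Complexification.

Definition cartan_decomposition {R : realType} {n : nat}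
    (br : 'rV[R]_n -> 'rV[R]_n -> 'rV[R]_n) (k p : {vspace 'rV[R]_n}) : Prop :=
  [/\ (k + p)%VS = fullv /\ (k :&: p)%VS = 0%VS,
      [/\ (commutatorv br k k <= k)%VS, (commutatorv br k p <= p)%VS &
          (commutatorv br p p <= k)%VS],
      forall x, x \in k -> x != 0 -> killing br x x < 0 &
      forall x, x \in p -> x != 0 -> 0 < killing br x x].

(* Roots take real values on h_R = i h0. An element of h_R^* is represented by
   the functional psi on h0 obtained by transport along h |-> i h: what is
   written psi h below, for h in h0, is the value at i h in h_R. *)
Notation hdual h0 := ('Hom(subvs_of h0, GRing.regular _)).

Section Roots.
Context {R : realType} {n : nat} (br : 'rV[R]_n -> 'rV[R]_n -> 'rV[R]_n).
Context {h0 : {vspace 'rV[R]_n}}.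
Implicit Types (alpha psi : hdual h0) (k p : {vspace 'rV[R]_n}).

Definition root_space alpha : set 'rV[R[i]]_n :=
  [set z | forall h : subvs_of h0,
     cplx_br br ('i%C *: cplx (vsval h)) z = (real_complex R (alpha h)) *: z].

Definition is_root alpha : Prop :=
  alpha != 0 /\ exists2 z, root_space alpha z & z != 0.

Definition compact_root k alpha : Prop :=
  forall z, root_space alpha z -> z \in cplxv k.

Definition noncompact_root p alpha : Prop :=
  forall z, root_space alpha z -> z \in cplxv p.

Definition root_sign k alpha : R := if `[< compact_root k alpha >] then -1 else 1.

(* h_psi is the element i (hcoord psi) of h_R; recall that
   B(i u, i h) = - B(u, h). *)
Definition hcoord psi : subvs_of h0 :=
  xget 0 [set u | forall h : subvs_of h0,
                    psi h = - killing br (vsval u) (vsval h)].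

(* v = i h_psi = - hcoord psi *)
Definition orbit_base psi : 'rV[R]_n := - vsval (hcoord psi).

Definition hform psi psi' : R :=
  - killing br (vsval (hcoord psi)) (vsval (hcoord psi')).

Section Base.
Context {l : nat} (gamma : 'I_l -> hdual h0).

Definition nonneg_comb alpha : Prop :=
  exists c : 'I_l -> nat, alpha = \sum_(i < l) gamma i *+ c i.

Definition root_base : Prop :=
  [/\ basis_of fullv [seq gamma i | i <- enum 'I_l],
      forall i, is_root (gamma i) &
      forall alpha, is_root alpha -> nonneg_comb alpha \/ nonneg_comb (- alpha)].

Definition positive_root alpha : Prop := is_root alpha /\ nonneg_comb alpha.

Definition dominant psi : Prop :=
  forall alpha, positive_root alpha -> 0 <= hform psi alpha.

End Base.

(* m_alpha = (g^alpha + g^(-alpha)) \cap g *)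
Definition real_root_space alpha : set 'rV[R]_n :=
  [set x | exists z w, [/\ root_space alpha z, root_space (- alpha) w &
                          cplx x = z + w]].

End Roots.

Inductive classical_type := TypeA | TypeB | TypeC | TypeD.

Definition classical_rank (T : classical_type) (l : nat) : bool :=
  match T with
  | TypeA => 1 <= l | TypeB => 2 <= l | TypeC => 3 <= l | TypeD => 4 <= l
  end%N.

(* Nodes are numbered from 0; in types A, B, C the node i is joined to i+1; in
   type D this holds for i+1 <= l-2, and the last node l-1 is joined to l-3. *)
Definition dynkin_edge (T : classical_type) (l i j : nat) : bool :=
  match T with
  | TypeD => ((i.+1 == j) && (j.+1 < l)) || ((i.+3 == l) && (j.+1 == l))
  | _ => i.+1 == j
  end%N.

(* Cartan integers 2 (gamma_i, gamma_j) / (gamma_i, gamma_i): the last simple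
   root is short in type B and long in type C. *)
Definition classical_cartan (T : classical_type) (l i j : nat) : int :=
  if i == j then 2 else
  if ~~ (dynkin_edge T l i j || dynkin_edge T l j i) then 0 else
  match T with
  | TypeB => if i.+1 == l then -2 else -1
  | TypeC => if j.+1 == l then -2 else -1
  | _ => -1
  end.

Record voganDiagram := VoganDiagram {
  vtype : classical_type;
  vrank : nat;
  vrankP : classical_rank vtype vrank;
  painted : {set 'I_vrank}
}.

Record vogan_realization {R : realType} (D : voganDiagram) {n : nat}
    (br : 'rV[R]_n -> 'rV[R]_n -> 'rV[R]_n) (k p h0 : {vspace 'rV[R]_n})
    (gamma : 'I_(vrank D) -> hdual h0) : Prop := VoganRealization {
  vr_bracket : lie_bracket br;
  vr_semisimple : lie_semisimple br;
  vr_cartan_decomposition : cartan_decomposition br k p;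
  vr_h0_sub : (h0 <= k)%VS;
  vr_h0_abelian : lie_abelian br h0;
  vr_h0_max : forall U, (U <= k)%VS -> lie_abelian br U -> (h0 <= U)%VS -> U = h0;
  vr_cartan : cartan_subalgebra (cplx_br br) (cplxv h0);
  vr_base : root_base br gamma;
  vr_cartan_matrix : forall i j,
    2 * hform br (gamma i) (gamma j) / hform br (gamma i) (gamma i) =
    (classical_cartan (vtype D) (vrank D) i j)%:~R;
  vr_painted : forall i, i \in painted D -> noncompact_root br p (gamma i);
  vr_unpainted : forall i, i \notin painted D -> compact_root br k (gamma i)
}.

HB.mixin Record Topological_isTopGroup G of Group G & Topological G := {
  mulg_continuous : continuous (fun xy : G * G => (xy.1 * xy.2)%g);
  invg_continuous : continuous (fun x : G => x^-1%g)
}.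

#[short(type="topGroupType")]
HB.structure Definition TopGroup :=
  {G of Topological_isTopGroup G & Group G & Topological G}.

Fixpoint Ck {R : realType} {V W : normedModType R} (k : nat) (U : set V)
    (f : V -> W) : Prop :=
  if k is k'.+1 then
    (forall x, U x -> differentiable f x) /\ (forall v, Ck k' U ('D_v f))
  else forall x, U x -> {for x, continuous f}.

Definition smooth_near {R : realType} {V W : normedModType R} (a : V)
    (f : V -> W) : Prop :=
  exists U : set V, [/\ open U, U a & forall k, Ck k U f].

(* A Lie group with Lie algebra (R^n, br), given by canonical coordinates of
   the first kind: lexp is the exponential map, llog its inverse near 1, the
   smooth structure is the one for which the maps x |-> g * lexp x are local
   parametrizations, and Ad is the adjoint representation, whose differential
   determines the bracket. *)
Record lieGroup {R : realType} {n : nat}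
    (br : 'rV[R]_n -> 'rV[R]_n -> 'rV[R]_n) := LieGroup {
  lgroup :> topGroupType;
  lg_hausdorff : hausdorff_space lgroup;
  lexp : 'rV[R]_n -> lgroup;
  llog : lgroup -> 'rV[R]_n;
  lexp_continuous : continuous lexp;
  lexpK : \forall x \near (0 : 'rV[R]_n), llog (lexp x) = x;
  llogK : \forall g \near (1%g : lgroup), lexp (llog g) = g;
  llog_continuous : \forall g \near (1%g : lgroup), {for g, continuous llog};
  lexpD : forall (s t : R) x, lexp ((s + t) *: x) = (lexp (s *: x) * lexp (t *: x))%g;
  lmul_smooth : smooth_near (0 : 'rV[R]_n * 'rV[R]_n)
    (fun xy => llog (lexp xy.1 * lexp xy.2)%g);
  Ad : lgroup -> 'rV[R]_n -> 'rV[R]_n;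
  Ad_linear : forall g (a : R) x y, Ad g (a *: x + y) = a *: Ad g x + Ad g y;
  Ad_lexp : forall g x, lexp (Ad g x) = (g * lexp x * g^-1)%g;
  Ad_smooth : forall g y,
    smooth_near (0 : 'rV[R]_n) (fun x => Ad (g * lexp x)%g y);
  Ad_derive : forall x y,
    is_derive (0 : R) 1 (fun t : R => Ad (lexp (t *: x)) y) (br x y)
}.

(* The map g |-> Ad g v identifies G/V, V the stabilizer of v, with the
   (immersed) adjoint orbit of v; x in m = T_e(G/V) corresponds to the tangent
   vector [x, v]. Tensors and vector fields on G/V are written on the orbit; a
   field is a function on the ambient space of which only the values along the
   orbit matter. *)
Section Orbit.
Context {R : realType} {n : nat} {br : 'rV[R]_n -> 'rV[R]_n -> 'rV[R]_n}.
Context (G : lieGroup br) (v : 'rV[R]_n).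
Implicit Types (xi eta : 'rV[R]_n -> 'rV[R]_n).
Implicit Types (J : 'rV[R]_n -> 'rV[R]_n -> 'rV[R]_n).

Definition stabilizer : set G := [set g | Ad g v = v].

Definition adjoint_orbit : set 'rV[R]_n := [set Ad g v | g in [set: G]].

Definition tangent (w : 'rV[R]_n) : set 'rV[R]_n := [set br x w | x in [set: _]].

Definition vector_field xi : Prop :=
  (forall w, adjoint_orbit w -> tangent w (xi w)) /\
  (forall g : G, smooth_near (0 : 'rV[R]_n) (fun x => xi (Ad (g * lexp G x)%g v))).

(* derivative of eta at w along the tangent vector u = [x, w], computed on the
   curve Ad (exp t x) w; for a smooth field it does not depend on x *)
Definition derive_along (u : 'rV[R]_n) eta (w : 'rV[R]_n) : 'rV[R]_n :=
  let x := xget 0 [set x | br x w = u] in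
  derive1 (fun t : R => eta (Ad (lexp G (t *: x)) w)) 0.

Definition field_bracket xi eta (w : 'rV[R]_n) : 'rV[R]_n :=
  derive_along (xi w) eta w - derive_along (eta w) xi w.

Definition app_field J xi (w : 'rV[R]_n) : 'rV[R]_n := J w (xi w).

Definition nijenhuis J xi eta (w : 'rV[R]_n) : 'rV[R]_n :=
  field_bracket (app_field J xi) (app_field J eta) w
  - J w (field_bracket (app_field J xi) eta w)
  - J w (field_bracket xi (app_field J eta) w)
  - field_bracket xi eta w.

Definition integrable_acs J : Prop :=
  forall xi eta, vector_field xi -> vector_field eta ->
  forall w, adjoint_orbit w -> nijenhuis J xi eta w = 0.

Definition invariant_acs J : Prop :=
  [/\ forall w, adjoint_orbit w -> forall (a : R) u u', tangent w u -> tangent w u' ->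
        J w (a *: u + u') = a *: J w u + J w u',
      forall w, adjoint_orbit w -> forall u, tangent w u ->
        tangent w (J w u) /\ J w (J w u) = - u &
      forall (g : G) w, adjoint_orbit w -> forall u, tangent w u ->
        J (Ad g w) (Ad g u) = Ad g (J w u)].

End Orbit.

Arguments stabilizer {R n br} G v.

Section Canonical.
Context {R : realType} {n : nat} {br : 'rV[R]_n -> 'rV[R]_n -> 'rV[R]_n}.
Context (G : lieGroup br) (k : {vspace 'rV[R]_n}) {h0 : {vspace 'rV[R]_n}}.
Context {l : nat} (gamma : 'I_l -> hdual h0) (phi : hdual h0).

Definition canonical_acs (J : 'rV[R]_n -> 'rV[R]_n -> 'rV[R]_n) : Prop :=
  let v := orbit_base br phi in
  invariant_acs G v J /\
  forall alpha, positive_root br gamma alpha -> hform br phi alpha != 0 ->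
  forall x, real_root_space br alpha x ->
    J v (br x v) =
    br ((root_sign br k alpha / hform br phi alpha) *: br v x) v.

End Canonical.

(* Main.v *)
Require Import Defs.
From HB Require Import structures.
From mathcomp Require Import all_boot all_order all_algebra.
From mathcomp Require Import complex ring lra zify.
From mathcomp Require Import all_classical all_reals all_analysis.

(** Write a root vector as e = x + i y with x, y in the real Lie algebra.  At
    the base point v the canonical structure multiplies e by i eps, where eps is
    the sign of the root, so the (1,0) vectors come from e when eps = 1 and from
    conj e when eps = -1.  Integrability would make the bracket of two (1,0)
    vectors of type (1,0) modulo the stabilizer of v.  Two non-compact positive
    roots with compact sum contradict this as soon as their root vectors have a
    non-zero bracket: both have sign 1, their sum has sign -1
    ([not_integrable_of_roots]).

    Two painted nodes produce such a pair.  A simple path between them, cut at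
    the first painted node that it meets, joins painted nodes i and j through
    unpainted ones.  Adding simple roots along it one at a time, each new simple
    root has negative product with the sum reached so far, so the bracket of the
    root vectors is non-zero ([br_root_vectors_neq0]) and the sum remains a
    root.  Before j only one non-compact simple root has been added, so the sum
    is non-compact; the non-compact simple root of j then makes it compact.

    It remains to see that these roots are not orthogonal to phi, and this is
    where compactness enters.  If a non-compact simple root were orthogonal to
    phi, the real part x of its root vector, an element of p, would commute with
    v, and all exp (t x) would lie in the stabilizer; but ad x has a positive
    eigenvalue, so Ad (exp (t x)) is unbounded
    ([compact_stabilizer_noncompact]).  Hence phi is strictly positive on the
    painted simple roots, and on every sum of simple roots containing one.

    The non-vanishing of brackets is derived from definiteness of the Killing
    form B on k and on p.  For e in g^alpha and z in g^beta, each in k or in p,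
    with [e, z] = 0, invariance of B gives
    N([conj e, z]) = - N(e) (beta, alpha) N(z), where N(e) = B(e, conj e), and
    the signs of the three values of N force (beta, alpha) >= 0 when e and z are
    non-zero.  Applied to conj e, this also shows that a root space meeting k
    lies in k ([root_vector_in_k]).

    On the analytic side the Nijenhuis tensor is evaluated at v only, on the
    fundamental fields w |-> [X, w].  Invariance of J turns the derivative of
    w |-> J [Y, w] along t |-> Ad (exp (t x)) v into an algebraic expression
    ([is_derive_J_line]), and [nijenhuis_br] collects the terms. *)

Set Implicit Arguments.
Unset Strict Implicit.
Unset Printing Implicit Defensive.

Import Order.TTheory GRing.Theory Num.Theory.
Import numFieldNormedType.Exports.

Local Open Scope classical_set_scope.
Local Open Scope ring_scope.

(** * Lie algebras and the Killing form *)

Section LieAlgebraFacts.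
Context {F : fieldType} {n : nat} {br : 'rV[F]_n -> 'rV[F]_n -> 'rV[F]_n}.
Context (lieb : lie_bracket br).
Implicit Types (x y z : 'rV[F]_n) (U V : {vspace 'rV[F]_n}).

Lemma brDl x y z : br (x + y) z = br x z + br y z.
Proof. by case: lieb => + _ _ _ => /(_ 1 x y z); rewrite !scale1r. Qed.

Lemma brDr x y z : br z (x + y) = br z x + br z y.
Proof. by case: lieb => _ + _ _ => /(_ 1 x y z); rewrite !scale1r. Qed.

Lemma br0l z : br 0 z = 0.
Proof. by have := brDl 0 0 z; rewrite addr0 => /eqP; rewrite -subr_eq subrr => /eqP<-. Qed.

Lemma br0r z : br z 0 = 0.
Proof. by have := brDr 0 0 z; rewrite addr0 => /eqP; rewrite -subr_eq subrr => /eqP<-. Qed.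

Lemma brZl a x z : br (a *: x) z = a *: br x z.
Proof. by case: lieb => + _ _ _ => /(_ a x 0 z); rewrite br0l !addr0. Qed.

Lemma brZr a x z : br z (a *: x) = a *: br z x.
Proof. by case: lieb => _ + _ _ => /(_ a x 0 z); rewrite br0r !addr0. Qed.

Lemma brNl x z : br (- x) z = - br x z.
Proof. by rewrite -scaleN1r brZl scaleN1r. Qed.

Lemma brNr x z : br z (- x) = - br z x.
Proof. by rewrite -scaleN1r brZr scaleN1r. Qed.

Lemma brBl x y z : br (x - y) z = br x z - br y z.
Proof. by rewrite brDl brNl. Qed.

Lemma brBr x y z : br z (x - y) = br z x - br z y.
Proof. by rewrite brDr brNr. Qed.

Lemma brxx x : br x x = 0.
Proof. by case: lieb => _ _ + _; apply. Qed.

Lemma brC x y : br x y = - br y x.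
Proof.
have := brxx (x + y); rewrite brDl !brDr !brxx add0r addr0 => /eqP.
by rewrite addr_eq0 => /eqP.
Qed.

Lemma br_jacobi x y z : br x (br y z) = br (br x y) z + br y (br x z).
Proof.
case: lieb => _ _ _ /(_ x y z) /eqP.
rewrite (brC z x) brNr (brC z (br x y)) -addrA -opprD subr_eq0 => /eqP ->.
by rewrite addrC.
Qed.

Lemma br_linear x : linear (br x).
Proof. by move=> a y z; rewrite brDr brZr. Qed.

Definition ad_mx x : 'M[F]_n := lin1_mx (br x).

Lemma mul_ad_mx x z : z *m ad_mx x = br x z.
Proof.
pose f : {linear 'rV[F]_n -> 'rV[F]_n} :=
  HB.pack (br x) (GRing.isLinear.Build _ _ _ _ _ (br_linear x)).
exact: (mul_rV_lin1 f).
Qed.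

(** Identities between ad matrices are checked by letting them act on row
    vectors, where composition reads from left to right. *)
Lemma rV_mx_ext (A B : 'M[F]_n) : (forall z : 'rV_n, z *m A = z *m B) -> A = B.
Proof. by move=> AB; apply/row_matrixP => i; rewrite !rowE AB. Qed.

Lemma ad_mxD x y : ad_mx (x + y) = ad_mx x + ad_mx y.
Proof. by apply: rV_mx_ext => z; rewrite mulmxDr !mul_ad_mx brDl. Qed.

Lemma ad_mxZ a x : ad_mx (a *: x) = a *: ad_mx x.
Proof. by apply: rV_mx_ext => z; rewrite -scalemxAr !mul_ad_mx brZl. Qed.

Lemma ad_mx_br x y : ad_mx (br x y) = ad_mx y *m ad_mx x - ad_mx x *m ad_mx y.
Proof.
apply: rV_mx_ext => z.
by rewrite mulmxBr !mulmxA !mul_ad_mx (br_jacobi x y) addrK.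
Qed.

Lemma killingE x y : killing br x y = \tr (ad_mx y *m ad_mx x).
Proof.
rewrite /killing; congr (\tr _); apply: rV_mx_ext => z.
have lin : linear (fun z => br x (br y z)).
  by move=> a u w; rewrite !(brDr, brZr).
pose f : {linear 'rV[F]_n -> 'rV[F]_n} :=
  HB.pack (fun z => br x (br y z)) (GRing.isLinear.Build _ _ _ _ _ lin).
by rewrite mulmxA !mul_ad_mx; exact: (mul_rV_lin1 f).
Qed.

Lemma killingC x y : killing br x y = killing br y x.
Proof. by rewrite !killingE mxtrace_mulC. Qed.

Lemma killingDl x y z : killing br (x + y) z = killing br x z + killing br y z.
Proof. by rewrite !killingE ad_mxD mulmxDr raddfD. Qed.

Lemma killingZl a x z : killing br (a *: x) z = a * killing br x z.
Proof. by rewrite !killingE ad_mxZ -scalemxAr mxtraceZ. Qed.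

Lemma killingNl x z : killing br (- x) z = - killing br x z.
Proof. by rewrite -scaleN1r killingZl mulN1r. Qed.

Lemma killingDr x y z : killing br z (x + y) = killing br z x + killing br z y.
Proof. by rewrite !(killingC z) killingDl. Qed.

Lemma killingZr a x z : killing br z (a *: x) = a * killing br z x.
Proof. by rewrite !(killingC z) killingZl. Qed.

Lemma killingNr x z : killing br z (- x) = - killing br z x.
Proof. by rewrite !(killingC z) killingNl. Qed.

Lemma killing0l z : killing br 0 z = 0.
Proof. by rewrite -(scale0r 0) killingZl mul0r. Qed.

(** The trace is cyclic and ad [x, y] is the commutator of ad x and ad y. *)
Lemma killing_invariant x y z : killing br (br x y) z = killing br x (br y z).
Proof.
rewrite !killingE !ad_mx_br mulmxBr mulmxBl !raddfB /= !mulmxA; congr (_ - _).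
by rewrite mxtrace_mulC mulmxA.
Qed.

Lemma mem_commutatorv U V x y : x \in U -> y \in V -> br x y \in commutatorv br U V.
Proof.
move=> xU yV; rewrite (coord_vbasis xU) (coord_vbasis yV).
have sumL (I : finType) (f : I -> 'rV[F]_n) w :
    br (\sum_i f i) w = \sum_i br (f i) w.
  by apply: (big_morph (br^~ w)) => [a b|]; rewrite ?brDl ?br0l.
have sumR (I : finType) (f : I -> 'rV[F]_n) w :
    br w (\sum_i f i) = \sum_i br w (f i).
  by apply: (big_morph (br w)) => [a b|]; rewrite ?brDr ?br0r.
rewrite sumL rpred_sum // => i _; rewrite sumR rpred_sum // => j _.
rewrite brZl brZr; do 2 apply: rpredZ; apply: memv_span.
by apply: allpairs_f; apply: mem_nth; rewrite size_tuple.
Qed.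

End LieAlgebraFacts.

(** * Root vectors as pairs of real vectors *)

Section ComplexVectors.
Context {R : realType} {n : nat}.
Implicit Types (z w : 'rV[R[i]]_n) (x y : 'rV[R]_n) (U : {vspace 'rV[R]_n}).

Definition rev z : 'rV[R]_n := map_mx (@complex.Re R) z.
Definition imv z : 'rV[R]_n := map_mx (@complex.Im R) z.

Lemma cvec_eq z w : rev z = rev w -> imv z = imv w -> z = w.
Proof.
move=> /rowP r /rowP i; apply/rowP => j; move: (r j) (i j); rewrite !mxE.
by case: (z 0 j) => a b; case: (w 0 j) => c d /= -> ->.
Qed.

Lemma rev_cplx x : rev (cplx x) = x.
Proof. by apply/rowP => j; rewrite !mxE. Qed.

Lemma imv_cplx x : imv (cplx x) = 0.
Proof. by apply/rowP => j; rewrite !mxE. Qed.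

Lemma rev_i x : rev ('i%C *: cplx x) = 0.
Proof. by apply/rowP => j; rewrite !mxE /=; ring. Qed.

Lemma imv_i x : imv ('i%C *: cplx x) = x.
Proof. by apply/rowP => j; rewrite !mxE /=; ring. Qed.

Lemma revD z w : rev (z + w) = rev z + rev w.
Proof. by apply/rowP => j; rewrite !mxE; case: (z 0 j); case: (w 0 j). Qed.

Lemma imvD z w : imv (z + w) = imv z + imv w.
Proof. by apply/rowP => j; rewrite !mxE; case: (z 0 j); case: (w 0 j). Qed.

Lemma revZ (c : R) z : rev (real_complex R c *: z) = c *: rev z.
Proof. by apply/rowP => j; rewrite !mxE; case: (z 0 j) => a b /=; ring. Qed.

Lemma imvZ (c : R) z : imv (real_complex R c *: z) = c *: imv z.
Proof. by apply/rowP => j; rewrite !mxE; case: (z 0 j) => a b /=; ring. Qed.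

Lemma rev_Zcplx (c : R[i]) x : rev (c *: cplx x) = complex.Re c *: x.
Proof. by apply/rowP => j; rewrite !mxE; case: c => a b /=; ring. Qed.

Lemma imv_Zcplx (c : R[i]) x : imv (c *: cplx x) = complex.Im c *: x.
Proof. by apply/rowP => j; rewrite !mxE; case: c => a b /=; ring. Qed.

Lemma cvecE z : z = cplx (rev z) + 'i%C *: cplx (imv z).
Proof.
by apply: cvec_eq; rewrite !(revD, imvD, rev_cplx, imv_cplx, rev_i, imv_i, addr0, add0r).
Qed.

Lemma cplx_sum (I : finType) (f : I -> 'rV[R]_n) :
  cplx (\sum_i f i) = \sum_i cplx (f i).
Proof. exact: raddf_sum. Qed.

Lemma cplx_mem U x : x \in U -> cplx x \in cplxv U.
Proof.
move=> xU; rewrite (coord_vbasis xU) cplx_sum rpred_sum // => i _.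
rewrite /cplx map_mxZ; apply: rpredZ; apply: memv_span; apply/map_f.
by apply: mem_nth; rewrite size_tuple.
Qed.

(** Membership in a complexified subspace, which is given as a complex span,
    is thereby tested on real vectors. *)
Lemma mem_cplxv U z : (z \in cplxv U) = (rev z \in U) && (imv z \in U).
Proof.
apply/idP/idP => [zU|/andP[rU iU]]; last first.
  by rewrite (cvecE z) rpredD ?rpredZ ?cplx_mem.
rewrite (@coord_span _ _ _ (in_tuple (map cplx (vbasis U))) _ zU).
have revsum (I : finType) (f : I -> 'rV[R[i]]_n) :
    rev (\sum_i f i) = \sum_i rev (f i).
  by apply: big_morph => [a b|]; [exact: revD|apply/rowP => j; rewrite !mxE].
have imvsum (I : finType) (f : I -> 'rV[R[i]]_n) :
    imv (\sum_i f i) = \sum_i imv (f i).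
  by apply: big_morph => [a b|]; [exact: imvD|apply/rowP => j; rewrite !mxE].
rewrite revsum imvsum; apply/andP; split; apply: rpred_sum => i _.
- have iU : (i < size (vbasis U))%N by case: i => i /=; rewrite size_map.
  by rewrite (nth_map 0) // rev_Zcplx; apply/rpredZ/vbasis_mem/mem_nth.
- have iU : (i < size (vbasis U))%N by case: i => i /=; rewrite size_map.
  by rewrite (nth_map 0) // imv_Zcplx; apply/rpredZ/vbasis_mem/mem_nth.
Qed.

End ComplexVectors.

(** The root vector x + i y of the complexification, recorded by its real and
    imaginary parts: [i h, x + i y] = alpha (x + i y) splits into two real
    equations.  All the root theory below takes place on such pairs. *)
Definition root_vector {R : realType} {n : nat}
    (br : 'rV[R]_n -> 'rV[R]_n -> 'rV[R]_n) {h0 : {vspace 'rV[R]_n}}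
    (alpha : hdual h0) (x y : 'rV[R]_n) : Prop := forall h : subvs_of h0,
  br (vsval h) x = (alpha h : R) *: y /\ br (vsval h) y = - (alpha h : R) *: x.

(** The Cartan decomposition as a grading by the booleans, with true for p: a
    statement about a root vector in k or in p is then proved once. *)
Definition part {R : realType} {n : nat} (k p : {vspace 'rV[R]_n}) (s : bool) :
  {vspace 'rV[R]_n} := if s then p else k.

Section RootVectors.
Context {R : realType} {n : nat} {br : 'rV[R]_n -> 'rV[R]_n -> 'rV[R]_n}.
Context {k p h0 : {vspace 'rV[R]_n}}.
Context (lieb : lie_bracket br) (cartan : cartan_decomposition br k p).
Context (h0k : (h0 <= k)%VS) (csa : cartan_subalgebra (cplx_br br) (cplxv h0)).
Implicit Types (x y a b : 'rV[R]_n) (alpha beta psi : hdual h0) (s t : bool).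

Lemma root_spaceP alpha z :
  root_space br alpha z <-> root_vector br alpha (rev z) (imv z).
Proof.
have brE (h : subvs_of h0) : cplx_br br ('i%C *: cplx (vsval h)) z =
    cplx (- br (vsval h) (imv z)) + 'i%C *: cplx (br (vsval h) (rev z)).
  rewrite /cplx_br -!/(rev _) -!/(imv _) rev_i imv_i !(br0l lieb).
  by rewrite sub0r add0r.
split=> H h.
- have := H h; rewrite brE => {}H; split.
    by rewrite -imvZ -H imvD imv_cplx imv_i add0r.
  by rewrite scaleNr -revZ -H revD rev_cplx rev_i addr0 opprK.
- have [hx hy] := H h; rewrite brE; apply: cvec_eq.
    by rewrite revD rev_cplx rev_i addr0 revZ hy scaleNr opprK.
  by rewrite imvD imv_cplx imv_i add0r imvZ hx.
Qed.

(** The complexification of h0 is its own normalizer, so a real vector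
    commuting with h0 already belongs to h0. *)
Lemma centralizer_h0 x : (forall h : subvs_of h0, br (vsval h) x = 0) -> x \in h0.
Proof.
move=> hx; case: csa => _ _ norm.
have brx y : y \in h0 -> br x y = 0.
  by move=> yh; rewrite (brC lieb) -(vsprojK yh) hx oppr0.
suff: cplx x \in cplxv h0 by rewrite mem_cplxv rev_cplx => /andP[].
apply: norm => z; rewrite mem_cplxv => /andP[rz iz].
rewrite /cplx_br -!/(rev _) -!/(imv _) rev_cplx imv_cplx !(br0l lieb).
rewrite !brx // !(subr0, addr0).
suff -> : cplx (0 : 'rV[R]_n) = 0 by rewrite scaler0 addr0 mem0v.
exact: raddf0.
Qed.

Lemma killing_h0_lt0 (h : subvs_of h0) : h != 0 ->
  killing br (vsval h) (vsval h) < 0.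
Proof.
move=> hn0; case: cartan => _ _ neg _; apply: neg.
  exact: (subvP h0k) (subvsP h).
by rewrite -(inj_eq val_inj) in hn0.
Qed.

(** B is negative definite on h0, a subspace of k; the map u |-> - B (u, _) into
    the dual is therefore injective, and surjective by equality of dimensions. *)
Lemma hcoordP psi h :
  (psi h : R) = - killing br (vsval (hcoord br psi)) (vsval h).
Proof.
rewrite /hcoord; move: h.
pose B (u h : subvs_of h0) : R^o := - killing br (vsval u) (vsval h).
have linB u : linear (B u).
  by move=> c x y; rewrite /B linearP /= (killingDr lieb) (killingZr lieb) opprD -mulrN.
pose Bl u : {linear subvs_of h0 -> R^o} :=
  HB.pack (B u) (GRing.isLinear.Build _ _ _ _ _ (linB u)).
pose L u : hdual h0 := linfun (Bl u).
have LE u h : L u h = - killing br (vsval u) (vsval h) by rewrite lfunE.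
have linL : linear L.
  move=> c x y; apply/lfunP => h; rewrite add_lfunE scale_lfunE !LE linearP /=.
  by rewrite (killingDl lieb) (killingZl lieb) opprD -mulrN.
pose Ll : {linear subvs_of h0 -> hdual h0} :=
  HB.pack L (GRing.isLinear.Build _ _ _ _ _ linL).
have ker0 : lker (linfun Ll) == 0%VS.
  apply/lker0P => u w; rewrite !(lfunE Ll) => /lfunP/(_ (u - w)) e.
  apply/eqP; rewrite -subr_eq0; apply: contraT => /killing_h0_lt0.
  move: e; rewrite [Ll u _]LE [Ll w _]LE => /oppr_inj/eqP.
  rewrite -subr_eq0 -(killingNl lieb) -(killingDl lieb) -raddfB /= => /eqP ->.
  by rewrite ltxx.
have : psi \in limg (linfun Ll).
  suff -> : limg (linfun Ll) = fullv by exact: memvf.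
  apply/eqP; rewrite eqEdim subvf /= limg_dim_eq ?(eqP ker0) ?capv0 //.
  by rewrite !dimvf /dim /= muln1.
case/memv_imgP => u _ psiE.
apply: (@xgetPex _ 0 [set u | forall h : subvs_of h0,
  psi h = - killing br (vsval u) (vsval h)]).
by exists u => h; rewrite psiE (lfunE Ll) [Ll u _]LE.
Qed.

Lemma hformE psi psi' : hform br psi psi' = (psi (hcoord br psi') : R).
Proof. by rewrite hcoordP. Qed.

Lemma hformC psi psi' : hform br psi psi' = hform br psi' psi.
Proof. by rewrite /hform (killingC lieb). Qed.

Lemma hformDl psi psi1 psi2 :
  hform br (psi1 + psi2) psi = hform br psi1 psi + hform br psi2 psi.
Proof. by rewrite !hformE lfunE. Qed.

Lemma hformNl psi psi1 : hform br (- psi1) psi = - hform br psi1 psi.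
Proof. by rewrite !hformE lfunE. Qed.

Lemma hform0l psi : hform br 0 psi = 0.
Proof. by rewrite hformE lfunE. Qed.

Lemma hformDr psi psi1 psi2 :
  hform br psi (psi1 + psi2) = hform br psi psi1 + hform br psi psi2.
Proof. by rewrite !(hformC psi) hformDl. Qed.

Lemma hform_gt0 psi : psi != 0 -> 0 < hform br psi psi.
Proof.
move=> psi0; rewrite /hform oppr_gt0 killing_h0_lt0 //.
apply: contra psi0 => /eqP u0; apply/eqP/lfunP => h.
by rewrite hcoordP u0 raddf0 (killing0l lieb) oppr0 lfunE.
Qed.

Lemma killing_h0_inj u w : u \in h0 -> w \in h0 ->
  (forall h : subvs_of h0, killing br u (vsval h) = killing br w (vsval h)) -> u = w.
Proof.
move=> uh wh H; apply/eqP; rewrite -subr_eq0; apply: contraT => n0.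
have uwh : u - w \in h0 by rewrite rpredB.
case: cartan => _ _ /(_ _ (subvP h0k _ uwh) n0) + _.
have := H (vsproj h0 (u - w)); rewrite vsprojK // => e.
by rewrite {1}(killingDl lieb) (killingNl lieb) e subrr ltxx.
Qed.

Lemma mem_part_br s t x y : x \in part k p s -> y \in part k p t -> br x y \in part k p (s (+) t).
Proof.
case: cartan => _ [kk kp pp] _ _.
case: s; case: t => /= xs yt.
- exact: (subvP pp) (mem_commutatorv lieb xs yt).
- by rewrite (brC lieb) rpredN; exact: (subvP kp) (mem_commutatorv lieb yt xs).
- exact: (subvP kp) (mem_commutatorv lieb xs yt).
- exact: (subvP kk) (mem_commutatorv lieb xs yt).
Qed.

Lemma part_disjoint x : x \in k -> x \in p -> x = 0.
Proof.
case: cartan => -[_ kp0] _ _ _ xk xp.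
by apply/eqP; rewrite -memv0 -kp0 memv_cap xk.
Qed.

(** The factor is the sign of B on the summand, so that arguments about signs
    treat k and p together. *)
Lemma killing_part s x : x \in part k p s -> x != 0 ->
  0 < (if s then 1 else -1) * killing br x x.
Proof.
case: cartan => _ _ neg pos; case: s => /= xs x0; rewrite ?mul1r ?mulN1r ?oppr_gt0.
  exact: pos.
exact: neg.
Qed.

Lemma killing_part_ge0 s x : x \in part k p s ->
  0 <= (if s then 1 else -1) * killing br x x.
Proof.
have [->|x0] := eqVneq x 0; first by rewrite (killing0l lieb) mulr0.
by move=> xs; apply/ltW/killing_part.
Qed.

(** Real and imaginary parts of [x + i y, a + i b]. *)
Lemma br_root_vectors alpha beta x y a b :
  root_vector br alpha x y -> root_vector br beta a b ->
  root_vector br (alpha + beta) (br x a - br y b) (br x b + br y a).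
Proof.
move=> rx ra h; have [hx hy] := rx h; have [ha hb] := ra h.
rewrite (brBr lieb) (brDr lieb) !(br_jacobi lieb (vsval h)) hx hy ha hb.
rewrite !((brZl lieb), (brZr lieb)) add_lfunE.
split; apply/rowP => i; rewrite !mxE; ring.
Qed.

(** Conjugation exchanges the root spaces of alpha and - alpha. *)
Lemma root_vectorN alpha x y : root_vector br alpha x y -> root_vector br (- alpha) x (- y).
Proof.
move=> r h; have [hx hy] := r h; rewrite (brNr lieb) opp_lfunE hx hy.
by rewrite scalerN !scaleNr !opprK.
Qed.

(** Multiplication by - i: it lets a statement about real parts be used for
    imaginary parts. *)
Lemma root_vector_rot alpha x y : root_vector br alpha x y -> root_vector br alpha y (- x).
Proof.
move=> r h; have [hx hy] := r h; rewrite (brNr lieb) hx hy.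
by rewrite scalerN !scaleNr.
Qed.

(** Some h in h0 has alpha h <> 0, and ad h then exchanges x and y up to
    non-zero scalars. *)
Lemma root_vector_eq0 alpha x y : alpha != 0 -> root_vector br alpha x y ->
  (x == 0) = (y == 0).
Proof.
move=> al0 r.
have [h hn0] : exists h, (alpha h : R) != 0.
  apply: contrapT => H; move/eqP: al0; apply; apply/lfunP => h; rewrite lfunE /=.
  by apply: contrapT => /eqP hn; apply: H; exists h.
have [hx hy] := r h; apply/eqP/eqP => e.
- move/eqP: hx; rewrite e (br0r lieb) eq_sym scaler_eq0 (negPf hn0) => /eqP //.
- by move/eqP: hy; rewrite e (br0r lieb) eq_sym scaler_eq0 oppr_eq0 (negPf hn0) => /eqP.
Qed.

(** The classical [e, conj e] = B(e, conj e) h_alpha: the bracket has weight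
    zero, hence lies in h0, and invariance of B determines its products with
    h0. *)
Lemma br_root_vector_coroot alpha x y : root_vector br alpha x y ->
  br x y = - killing br x x *: vsval (hcoord br alpha).
Proof.
move=> r.
have xyh : br x y \in h0.
  apply: centralizer_h0 => h; have [hx hy] := r h.
  by rewrite (br_jacobi lieb) hx hy (brZl lieb) (brZr lieb) !(brxx lieb) !scaler0 addr0.
apply: killing_h0_inj => // [|h]; first exact/rpredZ/subvsP.
have [hx hy] := r h.
rewrite (killingZl lieb) mulNr -mulrN -hcoordP (killing_invariant lieb).
by rewrite (brC lieb y) hy scaleNr opprK (killingZr lieb) mulrC.
Qed.

(** The replacement for root strings: if [e, z] = 0 for e = x + i y and
    z = a + i b, then N([conj e, z]) = - N(e) (beta, alpha) N(z), where N has a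
    fixed sign on each of k and p.  The three signs are incompatible with
    (beta, alpha) < 0. *)
Lemma br_root_vectors_neq0 s t alpha beta x y a b :
  root_vector br alpha x y -> x \in part k p s -> y \in part k p s -> (x != 0) || (y != 0) ->
  root_vector br beta a b -> a \in part k p t -> b \in part k p t -> (a != 0) || (b != 0) ->
  hform br beta alpha < 0 ->
  (br x a - br y b != 0) || (br x b + br y a != 0).
Proof.
move=> rx xs ys xy0 ra as_ bs ab0 neg.
have al0 : alpha != 0.
  by apply: contraTneq neg => ->; rewrite hformC hform0l ltxx.
have be0 : beta != 0 by apply: contraTneq neg => ->; rewrite hform0l ltxx.
have x0 : x != 0 by move: xy0; rewrite -(root_vector_eq0 al0 rx) orbb.
have b0 : b != 0 by move: ab0; rewrite (root_vector_eq0 be0 ra) orbb.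
rewrite -negb_and; apply: contraL neg => /andP[].
rewrite subr_eq0 addr_eq0 => /eqP e1 /eqP e2.
(* A quarter of N([conj e, z]): as [e, z] = 0, the parts of [conj e, z] are
   2 [x, a] and 2 [x, b]. *)
have key : killing br (br x a) (br x a) + killing br (br x b) (br x b) =
    - (killing br x x * hform br beta alpha * killing br b b).
  rewrite {2}e1 {2}e2 (killingNr lieb) (killingC lieb (br x a)).
  rewrite (brC lieb y b) (brC lieb x b) !(killingNl lieb) !(killing_invariant lieb).
  rewrite opprK addrC -(killingNr lieb) -(killingDr lieb).
  have -> : br x (br y a) - br y (br x a) = br (br x y) a.
    by rewrite (br_jacobi lieb x y) addrK.
  rewrite (br_root_vector_coroot rx) (brZl lieb).
  have [-> _] := ra (hcoord br alpha).
  by rewrite scalerA (killingZr lieb) -hformE mulNr mulNr.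
(* [conj e, z] lies in the summand of index s (+) t, on which B has the sign
   opposite to the product of its signs on the summands of e and z. *)
have pos := mulr_gt0 (killing_part xs x0) (killing_part bs b0).
rewrite -leNgt -(pmulr_rge0 _ pos).
have := killing_part_ge0 (mem_part_br xs as_).
have := killing_part_ge0 (mem_part_br xs bs).
by move: key; case: (s) => /=; case: (t) => /=; lra.
Qed.

(** Signs of roots are defined by all root vectors at once, so one root vector
    in k has to control the others.  The p-part z of another root vector is
    again a root vector, and [conj e, z] has weight zero and lies in p, so it
    vanishes because h0 is in k; as (alpha, - alpha) < 0, this forces z = 0. *)
Lemma root_vector_in_k alpha x y a b : alpha != 0 ->
  root_vector br alpha x y -> x \in k -> y \in k -> (x != 0) || (y != 0) ->
  root_vector br alpha a b -> a \in k /\ b \in k.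
Proof.
move=> al0 rx xk yk xy0 ra.
case: (cartan) => -[kp1 kp0] [kk kp pp] _ _.
have split c : exists c1 c2, [/\ c1 \in k, c2 \in p & c = c1 + c2].
  have : c \in (k + p)%VS by rewrite kp1 memvf.
  by case/memv_addP => c1 ? [c2 ? ->]; exists c1, c2.
have [a1 [a2 [a1k a2p ae]]] := split a; have [b1 [b2 [b1k b2p be]]] := split b.
have hk h c : c \in k -> br (vsval (h : subvs_of h0)) c \in k.
  by apply: (@mem_part_br false false); exact: (subvP h0k) (subvsP h).
have hp h c : c \in p -> br (vsval (h : subvs_of h0)) c \in p.
  by apply: (@mem_part_br false true); exact: (subvP h0k) (subvsP h).
have uniq c1 c2 d1 d2 : c1 \in k -> d1 \in k -> c2 \in p -> d2 \in p ->
    c1 + c2 = d1 + d2 -> c2 = d2.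
  move=> c1k d1k c2p d2p /eqP; rewrite -subr_eq -addrA addrC eq_sym -subr_eq eq_sym.
  move=> /eqP e; apply/eqP; rewrite -subr_eq0; apply/eqP/part_disjoint.
    by rewrite e rpredB.
  by rewrite rpredB.
have ra2 : root_vector br alpha a2 b2.
  move=> h; have [ha hb] := ra h; split.
    apply: (uniq (br (vsval h) a1) _ ((alpha h : R) *: b1)); rewrite ?rpredZ ?hk ?hp //.
    by rewrite -(brDr lieb) -scalerDr -ae -be.
  apply: (uniq (br (vsval h) b1) _ (- (alpha h : R) *: a1)); rewrite ?rpredZ ?hk ?hp //.
  by rewrite -(brDr lieb) -scalerDr -ae -be.
suff : (a2 == 0) && (b2 == 0).
  by case/andP => /eqP a20 /eqP b20; rewrite ae be a20 b20 !addr0.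
apply: contraT; rewrite negb_and => ab0.
have rN := root_vectorN rx.
have weight0 c d : root_vector br (0 : hdual h0) c d -> c \in p -> c == 0.
  move=> r cp; apply/eqP/part_disjoint => //; apply: (subvP h0k).
  by apply: centralizer_h0 => h; have [-> _] := r h; rewrite lfunE scale0r.
have xy0' : (x != 0) || (- y != 0) by rewrite oppr_eq0.
have yk' : - y \in k by rewrite rpredN.
have neg : hform br alpha (- alpha) < 0 by rewrite hformC hformNl oppr_lt0 hform_gt0.
have := @br_root_vectors_neq0 false true _ _ _ _ _ _ rN xk yk' xy0' ra2 a2p b2p ab0 neg.
have := br_root_vectors rN ra2; rewrite addNr => r0.
rewrite (weight0 _ _ r0) /=; last first.
  by rewrite rpredB //; [apply: (@mem_part_br false true)|apply: (@mem_part_br false true)].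
rewrite (weight0 _ _ (root_vector_rot r0)) //.
by rewrite rpredD //; [apply: (@mem_part_br false true)|apply: (@mem_part_br false true)].
Qed.

End RootVectors.

Section RootSigns.
Context {R : realType} {n : nat} {br : 'rV[R]_n -> 'rV[R]_n -> 'rV[R]_n}.
Context {k p h0 : {vspace 'rV[R]_n}}.
Context (lieb : lie_bracket br) (cartan : cartan_decomposition br k p).
Context (h0k : (h0 <= k)%VS) (csa : cartan_subalgebra (cplx_br br) (cplxv h0)).
Implicit Types (x y a b : 'rV[R]_n) (alpha beta psi : hdual h0) (s t : bool).

Lemma root_vector_scale alpha c x y :
  root_vector br alpha x y -> root_vector br alpha (c *: x) (c *: y).
Proof.
move=> r h; have [hx hy] := r h.
by rewrite !(brZr lieb) hx hy !scalerA ![c * _]mulrC.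
Qed.

Lemma root_space_cplx alpha x y :
  root_vector br alpha x y -> root_space br alpha (cplx x + 'i%C *: cplx y).
Proof.
move=> r; apply/(root_spaceP lieb).
by rewrite !(revD, imvD, rev_cplx, imv_cplx, rev_i, imv_i, addr0, add0r).
Qed.

(** x = (e + conj e) / 2 for e = x + i y. *)
Lemma root_vector_real_root_space alpha x y :
  root_vector br alpha x y -> real_root_space br alpha x.
Proof.
move=> r; have r2 := root_vector_scale 2^-1 r.
exists (cplx (2^-1 *: x) + 'i%C *: cplx (2^-1 *: y)),
       (cplx (2^-1 *: x) + 'i%C *: cplx (- (2^-1 *: y))).
split; [exact: root_space_cplx r2| exact: root_space_cplx (root_vectorN lieb r2)|].
apply: cvec_eq; rewrite !(revD, imvD, rev_cplx, imv_cplx, rev_i, imv_i, addr0, add0r).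
  by rewrite -scalerDl (_ : 2^-1 + 2^-1 = 1 :> R) ?scale1r //; field.
by rewrite subrr.
Qed.

Lemma root_vector_is_root alpha x y : alpha != 0 ->
  root_vector br alpha x y -> (x != 0) || (y != 0) -> is_root br alpha.
Proof.
move=> al0 r xy0; split=> //; exists (cplx x + 'i%C *: cplx y).
  exact: root_space_cplx.
apply: contraTneq xy0 => e.
have := congr1 rev e; have := congr1 imv e.
rewrite !(revD, imvD, rev_cplx, imv_cplx, rev_i, imv_i, addr0, add0r) => -> ->.
have -> : rev (0 : 'rV[R[i]]_n) = 0 by apply/rowP => j; rewrite !mxE.
have -> : imv (0 : 'rV[R[i]]_n) = 0 by apply/rowP => j; rewrite !mxE.
by rewrite eqxx.
Qed.

Lemma root_sign_part s alpha x y : alpha != 0 ->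
  root_vector br alpha x y ->
  x \in part k p s -> y \in part k p s ->
  (x != 0) || (y != 0) -> root_sign br k alpha = if s then 1 else -1.
Proof.
move=> al0 r xs ys xy0; rewrite /root_sign; case: asboolP => C; case: s xs ys => //= xs ys.
- have := C _ (root_space_cplx r); rewrite mem_cplxv.
  rewrite !(revD, imvD, rev_cplx, imv_cplx, rev_i, imv_i, addr0, add0r) => /andP[xk yk].
  move: xy0; rewrite (part_disjoint cartan xk xs) (part_disjoint cartan yk ys).
  by rewrite eqxx.
- exfalso; apply: C => z /(root_spaceP lieb) rz; rewrite mem_cplxv.
  by have [-> ->] := root_vector_in_k lieb cartan h0k csa al0 r xs ys xy0 rz.
Qed.

Lemma root_space_vector s alpha : is_root br alpha ->
  (forall z, root_space br alpha z -> z \in cplxv (part k p s)) ->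
  exists x y, [/\ root_vector br alpha x y,
    x \in part k p s, y \in part k p s &
    (x != 0) || (y != 0)].
Proof.
move=> [_ [z rz z0]] /(_ _ rz); rewrite mem_cplxv => /andP[xs ys].
exists (rev z), (imv z); split=> //; first exact/(root_spaceP lieb).
apply: contraNT z0; rewrite negb_or !negbK => /andP[/eqP x0 /eqP y0].
apply/eqP/cvec_eq; rewrite ?x0 ?y0; apply/rowP => j; by rewrite !mxE.
Qed.

End RootSigns.

(** * Paths in Dynkin diagrams *)

Section DynkinDiagram.

(** Every node except the first has a neighbour of smaller index, which gives
    connectedness by induction. *)
Lemma dynkin_edge_pred (T : classical_type) (l i : nat) : classical_rank T l ->
  (0 < i < l)%N -> exists2 j : nat, (j < i)%N & dynkin_edge T l j i.
Proof.
move=> rk /andP[i0 il].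
have [/andP[/eqP tD /eqP li]|nD] := boolP ((if T is TypeD then true else false) && (i.+1 == l)).
  (* In type D the last node is attached to the node two places before it. *)
  case: T rk tD => //= l4 _; exists i.-2; first by lia.
  by apply/orP; right; lia.
exists i.-1; first by lia.
by case: T rk nD => /= rk nD; rewrite ?prednK // eqxx //; apply/orP; left; lia.
Qed.

Definition diagram_adj (T : classical_type) (l : nat) : rel 'I_l :=
  fun i j => dynkin_edge T l i j || dynkin_edge T l j i.

Lemma diagram_adj_sym T l : symmetric (@diagram_adj T l).
Proof. by move=> i j; rewrite /diagram_adj orbC. Qed.

Lemma diagram_connected T l (i j : 'I_l) : classical_rank T l ->
  connect (@diagram_adj T l) i j.
Proof.
move=> rk; have l0 : (0 < l)%N by apply: leq_ltn_trans (ltn_ord i).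
have from0 m (ml : (m < l)%N) : connect (@diagram_adj T l) (Ordinal l0) (Ordinal ml).
  elim/ltn_ind: m ml => m IH ml; have [m0|m0] := posnP m.
    by rewrite (_ : Ordinal ml = Ordinal l0) //; apply/val_inj.
  have [m' m'm e] := dynkin_edge_pred rk (introT andP (conj m0 ml)).
  apply: connect_trans (IH _ m'm (ltn_trans m'm ml)) (connect1 _).
  by rewrite /diagram_adj /= e.
have csym := sym_connect_sym (@diagram_adj_sym T l).
apply: (@connect_trans _ _ (Ordinal l0)).
  by rewrite csym; case: i => m ml; exact: from0.
by case: j => m ml; exact: from0.
Qed.

(** Shorten a path between two distinct elements of A to a simple one, and keep
    its part up to the first element of A after the start. *)
Lemma painted_path T l (A : {set 'I_l}) : classical_rank T l -> (1 < #|A|)%N ->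
  exists i s j, [/\ path (@diagram_adj T l) i (rcons s j), uniq (i :: rcons s j),
    i \in A, j \in A & all (fun m => m \notin A) s].
Proof.
move=> rk /card_gt1P[i [b [iA bA ib]]].
have /connectP[q0 q0p q0b] := diagram_connected i b rk.
case/shortenP: q0p q0b => q qp qu _ bq.
have : has (mem A) q.
  case/lastP: q bq {qp qu} => [e|q b' e]; first by rewrite e eqxx in ib.
  by rewrite has_rcons /= -[b'](last_rcons i q) -e bA.
move=> hq; case: (split_find hq) qp qu => j s s2 jA nA.
rewrite cat_path -cat_cons cat_uniq => /andP[sp _] /and3P[su _ _].
by exists i, s, j; split => //; rewrite all_predC.
Qed.

Lemma classical_cartan_le0 T l (i j : nat) : i != j -> classical_cartan T l i j <= 0.
Proof.
move=> /negPf ij; rewrite /classical_cartan ij.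
by case: ifP => // _; case: T => //; case: ifP.
Qed.

Lemma classical_cartan_lt0 T l (i j : 'I_l) : i != j -> diagram_adj T i j ->
  classical_cartan T l i j < 0.
Proof.
move=> ij adj; rewrite /classical_cartan (inj_eq val_inj) (negPf ij).
by rewrite -/(diagram_adj T i j) adj /=; case: T {adj} => //; case: ifP.
Qed.

End DynkinDiagram.

(** * Derivatives of row-vector valued maps *)

Section RowDerivatives.
Context {R : realType} {V : normedModType R}.

Lemma is_derive_rowP n (f : V -> 'rV[R]_n) x v df :
  is_derive x v f df <->
  forall j, is_derive x v (fun t => f t 0 j : R) (df 0 j).
Proof.
split=> [fd j|fd].
- have d := @ex_derive _ _ _ _ _ _ _ fd.
  apply: DeriveDef; first exact: (derivable_mxP _ _ _).1 d 0 j.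
  by rewrite -(@derive_val _ _ _ _ _ _ _ fd) (derive_mx d) mxE.
- have d : derivable f x v.
    by apply/derivable_mxP => i j; rewrite (ord1 i); exact: (@ex_derive _ _ _ _ _ _ _ (fd j)).
  apply: DeriveDef => //; rewrite (derive_mx d); apply/rowP => j; rewrite mxE.
  exact: (@derive_val _ _ _ _ _ _ _ (fd j)).
Qed.

Lemma row_linear_sum n (W : lmodType R) (L : {linear 'rV[R]_n -> W}) u :
  L u = \sum_j u 0 j *: L (delta_mx 0 j).
Proof. rewrite {1}[u]row_sum_delta linear_sum; apply: eq_bigr => j _; exact: linearZZ. Qed.

Lemma row_linear_continuous n (W : normedModType R) (L : {linear 'rV[R]_n -> W}) :
  continuous L.
Proof.
move=> u; have -> : (L : _ -> _) = \sum_j (fun u : 'rV[R]_n => u 0 j *: L (delta_mx 0 j)).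
  by apply/funext => w; rewrite row_linear_sum fct_sumE.
elim/big_ind: _ => [|f g fc gc|j _]; first exact: (@cst_continuous _ _ (0 : W)).
  exact: (cvgD fc gc).
exact: (@cvgZr_tmp _ _ _ (nbhs u) _ _ _ _ (@coord_continuous R 1 n 0 j u)).
Qed.

Lemma is_derive_linear n m (L : {linear 'rV[R]_n -> 'rV[R]_m})
    (f : V -> 'rV[R]_n) x v df :
  is_derive x v f df -> is_derive x v (L \o f) (L df).
Proof.
move=> /is_derive_rowP fd; apply/is_derive_rowP => j.
have -> : (fun t => (L \o f) t 0 j) =
    \sum_i (fun t => f t 0 i * L (delta_mx 0 i) 0 j).
  apply/funext => t /=; rewrite row_linear_sum summxE fct_sumE.
  by apply: eq_bigr => i _; rewrite mxE.
have fdi i : is_derive x v (fun t => f t 0 i * L (delta_mx 0 i) 0 j)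
    (df 0 i * L (delta_mx 0 i) 0 j).
  have := @is_deriveM _ _ (fun t => f t 0 i : R) (cst (L (delta_mx 0 i) 0 j)) x v _ _ (fd i) _.
  move=> /(_ _ (is_derive_cst _ _ _)) H; apply: (is_derive_eq H).
  by rewrite scaler0 add0r /= mulrC.
have := @is_derive_sum _ _ _ _ _ x v _ fdi => H.
apply: (is_derive_eq H).
by rewrite row_linear_sum summxE; apply: eq_bigr => i _; rewrite mxE.
Qed.

(** Leibniz rule for a curve of linear maps applied to a curve of vectors. *)
Lemma is_derive_row_product n m (A : V -> {linear 'rV[R]_n -> 'rV[R]_m})
    (dA : {linear 'rV[R]_n -> 'rV[R]_m}) (c : V -> 'rV[R]_n) x v dc :
  (forall y, is_derive x v (fun t => A t y) (dA y)) -> is_derive x v c dc ->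
  is_derive x v (fun t => A t (c t)) (dA (c x) + A x dc).
Proof.
move=> dAP /is_derive_rowP cP; apply/is_derive_rowP => j.
have -> : (fun t => A t (c t) 0 j) =
    \sum_i (fun t => c t 0 i * A t (delta_mx 0 i) 0 j).
  apply/funext => t /=; rewrite row_linear_sum summxE fct_sumE.
  by apply: eq_bigr => i _; rewrite mxE.
have fdi i : is_derive x v (fun t => c t 0 i * A t (delta_mx 0 i) 0 j)
    (c x 0 i * dA (delta_mx 0 i) 0 j + dc 0 i * A x (delta_mx 0 i) 0 j).
  have Ai := (is_derive_rowP _ _ _ _).1 (dAP (delta_mx 0 i)) j.
  have H := @is_deriveM _ _ _ _ x v _ _ (cP i) Ai.
  by apply: (is_derive_eq H); rewrite /= [X in _ + X = _]mulrC.
have H := @is_derive_sum _ _ _ _ _ x v _ fdi.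
apply: (is_derive_eq H).
rewrite mxE (row_linear_sum dA) (row_linear_sum (A x)) !summxE -big_split /=.
by apply: eq_bigr => i _; rewrite !mxE.
Qed.

End RowDerivatives.

Lemma is_derive_translate {R : realType} (W : normedModType R) (f : R -> W) t d :
  is_derive (0 : R) 1 (fun s => f (s + t)) d -> is_derive t 1 f d.
Proof.
have e : (fun h : R => h^-1 *: (((fun s => f (s + t)) \o shift 0) (h *: 1) - f (0 + t))) =
    (fun h : R => h^-1 *: ((f \o shift t) (h *: 1) - f t)).
  by apply/funext => h /=; rewrite addr0 add0r.
by case=> + <-; rewrite /derivable /derive e => d0; apply: DeriveDef.
Qed.

Section SmoothMaps.
Context {R : realType} {V : normedModType R}.

(** Differentiability is a first-order expansion, which depends on the germ
    only; the differential of f serves for g. *)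
Lemma near_eq_differentiable (W : normedModType R) (f g : V -> W) (a : V) :
  (\near a, f a = g a) -> differentiable f a -> differentiable g a.
Proof.
move=> fg df; have fga : f a = g a := nbhs_singleton fg.
have dg : g \o shift a = cst (g a) + 'd f a +o_ 0 id.
  apply/eqaddoP => e e0; have /eqaddoP/(_ e e0) := diff_locally df.
  have fg0 : \forall h \near 0, f (h + a) = g (h + a).
    by move: fg; rewrite (near_shift 0 a) subr0.
  apply: filterS2 fg0 => h /= fgh; rewrite !fctE /= fgh fga //.
apply/diff_locallyP.
have -> : ('d g a : V -> W) = 'd f a by apply: diff_unique => //; exact: diff_continuous.
by split => //; exact: diff_continuous.
Qed.

Lemma eq_Ck (W : normedModType R) k (U : set V) (f g : V -> W) : open U ->
  (forall x, U x -> f x = g x) -> Ck k U f -> Ck k U g.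
Proof.
move=> oU; elim: k f g => [|k IH] f g fg /=.
  move=> cf x Ux; have nfg : \forall y \near x, f y = g y.
    by apply: filterS (open_nbhs_nbhs (conj oU Ux)) => y; exact: fg.
  rewrite /prop_for /continuous_at -(fg x Ux).
  apply: cvg_trans (cf x Ux); apply: near_eq_cvg; exact: nfg.
have nfg x : U x -> \forall y \near x, f y = g y.
  by move=> Ux; apply: filterS (open_nbhs_nbhs (conj oU Ux)) => y; exact: fg.
case=> df Df; split=> [x Ux|v].
  exact: near_eq_differentiable (nfg x Ux) (df x Ux).
by apply: IH (Df v) => x Ux; apply: near_eq_derive; exact: nfg.
Qed.

(** The derivatives of L \o f agree with L applied to those of f on U only,
    whence the passage through [eq_Ck]. *)
Lemma Ck_linear_comp n m (L : {linear 'rV[R]_n -> 'rV[R]_m}) k (U : set V)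
  (f : V -> 'rV[R]_n) : open U -> Ck k U f -> Ck k U (L \o f).
Proof.
move=> oU; elim: k f => [|k IH] f /=.
  by move=> cf x Ux; apply: continuous_comp; [exact: cf|exact: row_linear_continuous].
case=> df Df; split=> [x Ux|v].
  apply: differentiable_comp; first exact: df.
  by apply: linear_differentiable; exact: row_linear_continuous.
apply: (eq_Ck oU _ (IH _ (Df v))) => x Ux /=.
have fd : is_derive x v f ('D_v f x) by apply: derivableP; apply/diff_derivable/df.
by have := is_derive_linear L fd => -[_ <-].
Qed.

Lemma smooth_near_linear_comp n m (L : {linear 'rV[R]_n -> 'rV[R]_m}) (a : V)
  (f : V -> 'rV[R]_n) : smooth_near a f -> smooth_near a (L \o f).
Proof.
by case=> U [oU Ua fU]; exists U; split => // k; apply: Ck_linear_comp.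
Qed.

End SmoothMaps.

(** * The adjoint representation of a Lie group *)

Section LieGroupFacts.
Context {R : realType} {n : nat} {br : 'rV[R]_n -> 'rV[R]_n -> 'rV[R]_n}.
Context (lieb : lie_bracket br) (G : lieGroup br).
Implicit Types (g h : G) (x y u w : 'rV[R]_n).

Local Notation exp := (lexp G).

Lemma lexp0 : exp 0 = 1%g.
Proof.
have := lexpD G 0 0 0; rewrite !scaler0 => e.
by apply: (@mulgI _ (exp 0)); rewrite -e mulg1.
Qed.

Lemma lexpN x : exp (- x) = (exp x)^-1%g.
Proof.
have := lexpD G 1 (-1) x; rewrite subrr scale0r lexp0 scale1r scaleN1r => e.
by apply: (@mulgI _ (exp x)); rewrite -e mulgV.
Qed.

(** lexp is injective near 0, and the two lines enter that neighbourhood. *)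
Lemma lexp_line_inj u w : (forall s : R, exp (s *: u) = exp (s *: w)) -> u = w.
Proof.
move=> H.
have near_line x : \forall s \near (0 : R), llog (exp (s *: x)) = s *: x.
  have : (fun s : R => s *: x) s @[s --> (0 : R)] --> (0 : 'rV[R]_n).
    by rewrite -[X in _ --> X](scale0r x); apply: cvgZr_tmp; exact: cvg_id.
  by move=> /(_ _ (lexpK G)).
near (0 : R)^' => s.
have s0 : s != 0 by near: s; exact: nbhs_dnbhs_neq.
suff : s *: u = s *: w by move/(scalerI s0).
have <- : llog (exp (s *: u)) = s *: u.
  by near: s; apply: nbhs_dnbhs; exact: near_line.
rewrite H; near: s; apply: nbhs_dnbhs; exact: near_line.
Unshelve. all: by end_near. Qed.

Lemma AdZ g a x : Ad g (a *: x) = a *: Ad g x.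
Proof.
have Ad0 : Ad g 0 = 0.
  by have /eqP := Ad_linear g 1 0 0; rewrite !scale1r addr0 -subr_eq subrr => /eqP<-.
by have := Ad_linear g a x 0; rewrite Ad0 !addr0.
Qed.

(** That Ad is a representation follows from its compatibility with lexp:
    both sides generate the same one-parameter group. *)
Lemma AdM g h x : Ad (g * h)%g x = Ad g (Ad h x).
Proof.
apply: lexp_line_inj => s; rewrite -!AdZ !Ad_lexp invgM !mulgA //.
Qed.

Lemma Ad1 x : Ad (1%g : G) x = x.
Proof. by apply: lexp_line_inj => s; rewrite -AdZ Ad_lexp mul1g invg1 mulg1. Qed.

Lemma AdK g x : Ad g (Ad g^-1%g x) = x.
Proof. by rewrite -AdM mulgV Ad1. Qed.

Lemma AdVK g x : Ad g^-1%g (Ad g x) = x.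
Proof. by rewrite -AdM mulVg Ad1. Qed.

Definition Adl g : {linear 'rV[R]_n -> 'rV[R]_n} :=
  HB.pack (Ad g) (GRing.isLinear.Build _ _ _ _ _ (Ad_linear g)).

Definition adl x : {linear 'rV[R]_n -> 'rV[R]_n} :=
  HB.pack (br x) (GRing.isLinear.Build _ _ _ _ _ (br_linear lieb x)).

Lemma Ad_lexp_derive x y (t : R) :
  is_derive t (1 : R) (fun t => Ad (exp (t *: x)) y) (Ad (exp (t *: x)) (br x y)).
Proof.
have e : (fun s : R => Ad (exp ((s + t) *: x)) y) =
    Adl (exp (t *: x)) \o (fun s => Ad (exp (s *: x)) y).
  by apply/funext => s /=; rewrite addrC lexpD AdM.
by apply: is_derive_translate; rewrite e; apply: is_derive_linear; exact: Ad_derive.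
Qed.

(** t |-> exp (- mu t) Ad (lexp (t x)) w has zero derivative, so it is
    constant. The case mu = 0 says that lexp (t x) fixes the vectors commuting
    with x. *)
Lemma Ad_lexp_eigen x w (mu t : R) : br x w = mu *: w ->
  Ad (exp (t *: x)) w = expR (mu * t) *: w.
Proof.
move=> xw; apply/rowP => j.
pose F s : R := expR (- mu * s) * Ad (exp (s *: x)) w 0 j.
have F0 s : is_derive s (1 : R) F 0.
  have dA := (is_derive_rowP _ _ _ _).1 (Ad_lexp_derive x w s) j.
  have dl : is_derive s (1 : R) (fun s => - mu * s) (- mu).
    have H := @is_deriveZ _ _ _ (@id R) (- mu) s 1 1 (is_derive_id _ _).
    by apply: (is_derive_eq H); rewrite [LHS]mulr1.
  have dE : is_derive s (1 : R) (fun s => expR (- mu * s)) (- mu * expR (- mu * s)).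
    have H := @is_derive1_comp _ expR _ _ _ _ (is_derive_expR _) dl.
    by apply: (is_derive_eq H); rewrite mulrC.
  have H := is_deriveM dE dA; apply: (is_derive_eq H).
  rewrite xw AdZ !mxE /GRing.scale /=; ring.
rewrite mxE; have := is_derive_0_is_cst t 0 F0; rewrite /F mulr0 expR0 mul1r scale0r lexp0 Ad1 => <-.
by rewrite mulrA -expRD mulNr addrN expR0 mul1r.
Qed.

(** Differentiate Ad (g lexp (t y) g^-1) Ad g z, where g lexp (t y) g^-1 is
    lexp (t Ad g y), in two ways. *)
Lemma Ad_br g y z : Ad g (br y z) = br (Ad g y) (Ad g z).
Proof.
have H1 := is_derive_linear (Adl g) (Ad_derive G y z).
have e : Adl g \o (fun t : R => Ad (exp (t *: y)) z) =
    (fun t => Ad (exp (t *: Ad g y)) (Ad g z)).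
  by apply/funext => t /=; rewrite -AdZ Ad_lexp !AdM AdVK.
rewrite e in H1.
have H2 := Ad_derive G (Ad g y) (Ad g z).
by rewrite -(@derive_val _ _ _ _ _ _ _ H2) -[LHS](@derive_val _ _ _ _ _ _ _ H1).
Qed.

(** Smoothness of Ad is given in the charts x |-> g lexp x; llog brings it to
    the topology of the group. *)
Lemma Ad_continuous y : continuous (fun g : G => Ad g y).
Proof.
move=> g0.
have llog1 : llog (1%g : G) = 0 by rewrite -lexp0; exact: nbhs_singleton (lexpK G).
have cF : {for 0, continuous (fun x => Ad (g0 * exp x)%g y)}.
  by case: (Ad_smooth g0 y) => U [oU U0 /(_ 0%N)]; apply.
have ct : (fun g : G => (g0^-1 * g)%g) g @[g --> g0] --> (1%g : G).
  rewrite -(mulVg g0).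
  have H := @mulg_continuous G (g0^-1%g, g0).
  have P : (fun g : G => (g0^-1%g, g)) g @[g --> g0] --> (g0^-1%g, g0).
    by apply: cvg_pair; [exact: cvg_cst|exact: cvg_id].
  exact: (cvg_comp _ _ P H).
have cl : (fun g : G => llog (g0^-1 * g)%g) g @[g --> g0] --> (0 : 'rV[R]_n).
  rewrite -llog1; apply: (cvg_comp _ _ ct).
  exact: nbhs_singleton (llog_continuous G).
have ce : \forall g \near g0, Ad (g0 * exp (llog (g0^-1 * g)))%g y = Ad g y.
  have := ct _ (llogK G); rewrite /nbhs /= => H.
  by apply: filterS H => g /= ->; rewrite mulgA mulgV mul1g.
rewrite /continuous_at; have := cvg_comp _ _ cl cF.
rewrite /= lexp0 mulg1 => H; apply: cvg_trans H.
by apply: near_eq_cvg.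
Qed.

(** On a compact set g |-> Ad g w is bounded, while along the line it is
    w scaled by exp (mu t). *)
Lemma compact_lexp_line_eigen (K : set G) x w (mu : R) : compact K ->
  (forall t : R, K (exp (t *: x))) -> br x w = mu *: w -> 0 < mu -> w = 0.
Proof.
move=> cK Kx xw mu0.
have /compact_bounded[M [_ Mb]] : compact [set Ad g w | g in K].
  apply: continuous_compact cK; apply: continuous_subspaceT; exact: Ad_continuous.
have bound t : expR (mu * t) * `|w| <= M + 1.
  have := Mb (M + 1); rewrite ltrDl => /(_ ltr01 (Ad (exp (t *: x)) w)).
  rewrite (Ad_lexp_eigen t xw) /= normrZ ger0_norm ?expR_ge0 //; apply.
  by exists (exp (t *: x)) => //; rewrite (Ad_lexp_eigen t xw).
apply/eqP; apply: contraT => w0; have w1 : 0 < `|w| by rewrite normr_gt0.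
(* At this time mu t = (M + 1) / `|w|, and exp u >= 1 + u exceeds the bound. *)
have := bound ((M + 1) / `|w| / mu).
have -> : mu * ((M + 1) / `|w| / mu) = (M + 1) / `|w|.
  by rewrite mulrC divfK // gt_eqF.
rewrite -ler_pdivlMr // leNgt (lt_le_trans _ (expR_ge1Dx _)) //.
by rewrite ltrDr.
Qed.

End LieGroupFacts.

(** * The Nijenhuis tensor on fundamental vector fields *)

Section OrbitNijenhuis.
Context {R : realType} {n : nat} {br : 'rV[R]_n -> 'rV[R]_n -> 'rV[R]_n}.
Context (lieb : lie_bracket br) (G : lieGroup br) (v : 'rV[R]_n).
Context (J : 'rV[R]_n -> 'rV[R]_n -> 'rV[R]_n) (invJ : invariant_acs G v J).
Implicit Types (X Y x y u w : 'rV[R]_n).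

Local Notation exp := (lexp G).

Lemma orbit_refl : adjoint_orbit G v v.
Proof. by exists 1%g => //; exact: Ad1. Qed.

Lemma tangent_br X w : tangent (br := br) w (br X w).
Proof. by exists X. Qed.

Lemma vector_field_br X : vector_field G v (br X).
Proof.
split=> [w _|g]; first exact: tangent_br.
exact: (smooth_near_linear_comp (adl lieb X) (Ad_smooth g v)).
Qed.

Lemma J_linear : linear (fun X => J v (br X v)).
Proof.
case: invJ => lin _ _ a X Y; rewrite (brDl lieb) (brZl lieb).
by rewrite lin //; exact: orbit_refl || exact: tangent_br.
Qed.

(** X |-> J X^* at v, for the fundamental field X^* w = [X, w].  Unlike J v,
    which is linear on the tangent space only, it is linear on the whole
    Lie algebra. *)
Definition Jfund : {linear 'rV[R]_n -> 'rV[R]_n} :=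
  HB.pack (fun X => J v (br X v)) (GRing.isLinear.Build _ _ _ _ _ J_linear).

Lemma JfundE X : Jfund X = J v (br X v). Proof. by []. Qed.

Lemma J_sqr X : J v (Jfund X) = - br X v.
Proof.
case: invJ => _ sq _.
by have [] := sq v orbit_refl (br X v) (tangent_br X v).
Qed.

(** Invariance expresses J [Y, .] at any point of the orbit by its values at
    v. *)
Lemma J_Ad (g : G) Y : J (Ad g v) (br Y (Ad g v)) = Ad g (Jfund (Ad g^-1%g Y)).
Proof.
case: invJ => _ _ equi.
rewrite JfundE -equi //; [|exact: orbit_refl|exact: tangent_br].
by rewrite Ad_br AdK.
Qed.

(** By [J_Ad] the curve is Ad (lexp (t x)) applied to
    Jfund (Ad (lexp (- t x)) Y): the two terms are the two factors of the
    product rule. *)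
Lemma is_derive_J_line x Y :
  is_derive (0 : R) 1 (fun t => app_field J (br Y) (Ad (exp (t *: x)) v))
    (br x (Jfund Y) - Jfund (br x Y)).
Proof.
have -> : (fun t => app_field J (br Y) (Ad (exp (t *: x)) v)) =
    (fun t => Adl (exp (t *: x)) (Jfund (Ad (exp (t *: (- x))) Y))).
  by apply/funext => t; rewrite /app_field J_Ad scalerN lexpN.
have dc := is_derive_linear Jfund (Ad_derive G (- x) Y).
have H := is_derive_row_product (A := fun t : R => Adl (exp (t *: x))) (dA := adl lieb x)
  (fun y => Ad_derive G x y) dc.
apply: (is_derive_eq H) => /=.
by rewrite !scale0r !lexp0 !Ad1 (brNl lieb) -!JfundE (linearN Jfund).
Qed.

(** For x commuting with v the curve stays at v. *)
Lemma derive_line_stabilizer x Y : br x v = 0 -> br x (Jfund Y) - Jfund (br x Y) = 0.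
Proof.
move=> xv; have H := is_derive_J_line x Y.
have e : (fun t => app_field J (br Y) (Ad (exp (t *: x)) v)) = cst (Jfund Y).
  apply/funext => t; have xv0 : br x v = 0 *: v by rewrite scale0r.
  by rewrite (Ad_lexp_eigen G t xv0) mul0r expR0 scale1r.
rewrite e in H; rewrite -(@derive_val _ _ _ _ _ _ _ H).
exact: derive_cst.
Qed.

(** Directional derivatives are computed on a chosen curve; a value common to
    all curves with the same tangent is the derivative. *)
Lemma derive_alongE u eta x d :
  (forall y, br y v = u -> is_derive (0 : R) 1 (fun t => eta (Ad (exp (t *: y)) v)) d) ->
  br x v = u -> derive_along G u eta v = d.
Proof.
move=> H xu; rewrite /derive_along derive1E.
have yu : br (xget 0 [set y | br y v = u]) v = u.
  exact: (@xgetPex _ 0 [set y | br y v = u] (ex_intro _ x xu)).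
by case: (H _ yu).
Qed.

Lemma derive_along_br X Y : derive_along G (br X v) (br Y) v = br Y (br X v).
Proof.
apply: (@derive_alongE _ _ X) => // y <-.
exact: (is_derive_linear (adl lieb Y) (Ad_derive G y v)).
Qed.

(** Two choices of curve differ by an element commuting with v, which
    contributes nothing by [derive_line_stabilizer]. *)
Lemma derive_along_J X Y :
  derive_along G (br X v) (app_field J (br Y)) v = br X (Jfund Y) - Jfund (br X Y).
Proof.
apply: (@derive_alongE _ _ X) => // y yX.
apply: (is_derive_eq (is_derive_J_line y Y)).
apply/eqP; rewrite -subr_eq0; apply/eqP.
have <- : br (y - X) (Jfund Y) - Jfund (br (y - X) Y) = 0.
  by apply: derive_line_stabilizer; rewrite (brBl lieb) yX subrr.
rewrite !(brBl lieb) (linearB Jfund).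
by apply/rowP => i; rewrite !mxE; ring.
Qed.

(** The homogeneous-space formula for the Nijenhuis tensor, modulo the
    stabilizer algebra: [JX, JY] - J([JX, Y] + [X, JY]) - [X, Y], with X' and Y'
    representing JX and JY. *)
Lemma nijenhuis_br X Y X' Y' : Jfund X = br X' v -> Jfund Y = br Y' v ->
  nijenhuis G J (br X) (br Y) v =
  br (br X' Y') v - Jfund (br X' Y + br X Y') - br (br X Y) v.
Proof.
move=> eX eY; rewrite /nijenhuis.
have JJ : field_bracket G (app_field J (br X)) (app_field J (br Y)) v =
    br (br X' Y') v - Jfund (br X' Y + br X Y').
  rewrite /field_bracket [app_field J (br X) v]eX [app_field J (br Y) v]eY.
  rewrite !derive_along_J eX eY (br_jacobi lieb X') (linearD Jfund).
  rewrite (brC lieb X Y') -/(Jfund _) (linearN Jfund).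
  by apply/rowP => i; rewrite !mxE; ring.
have J1 : field_bracket G (app_field J (br X)) (br Y) v = Jfund (br Y X).
  rewrite /field_bracket [app_field J (br X) v]eX.
  rewrite derive_along_J derive_along_br eX.
  by rewrite opprB addrC subrK.
have J2 : field_bracket G (br X) (app_field J (br Y)) v = Jfund (br Y X).
  rewrite /field_bracket [app_field J (br Y) v]eY.
  rewrite derive_along_J derive_along_br eY.
  by rewrite addrAC subrr add0r (brC lieb X) (linearN Jfund) opprK.
have J0 : field_bracket G (br X) (br Y) v = - br (br X Y) v.
  rewrite /field_bracket !derive_along_br (br_jacobi lieb X).
  by rewrite opprD addrCA addrA addrK.
rewrite JJ J1 J2 J0 J_sqr (brC lieb Y X) (brNl lieb).
by apply/rowP => i; rewrite !mxE; ring.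
Qed.

End OrbitNijenhuis.

(** * Criterion for non-integrability *)

Section CanonicalStructure.
Context {R : realType} {n : nat} {br : 'rV[R]_n -> 'rV[R]_n -> 'rV[R]_n}.
Context {k p h0 : {vspace 'rV[R]_n}}.
Context (lieb : lie_bracket br) (cartan : cartan_decomposition br k p).
Context (h0k : (h0 <= k)%VS) (csa : cartan_subalgebra (cplx_br br) (cplxv h0)).
Implicit Types (x y a b : 'rV[R]_n) (alpha beta phi psi : hdual h0).

(** v = i h_phi acts on root vectors of alpha by i (phi, alpha). *)
Lemma br_orbit_base phi alpha x y : root_vector br alpha x y ->
  br x (orbit_base br phi) = hform br phi alpha *: y /\
  br y (orbit_base br phi) = - hform br phi alpha *: x.
Proof.
move=> r; have [hx hy] := r (hcoord br phi).
rewrite /orbit_base !(brNr lieb) !(brC lieb _ (vsval _)) hx hy opprK.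
by rewrite (hformC lieb) (hformE lieb cartan h0k) scaleNr !opprK.
Qed.

(** If (phi, gamma) = 0, the real part x of the root vector commutes with v.
    Being in p, it spans with y and [x, y] a copy of sl2 in which ad x is
    hyperbolic, so its one-parameter group cannot stay in a compact set. *)
Lemma compact_stabilizer_noncompact (G : lieGroup br) phi gamma x y :
  compact (stabilizer G (orbit_base br phi)) -> gamma != 0 ->
  root_vector br gamma x y -> x \in p -> y \in p -> (x != 0) || (y != 0) ->
  hform br phi gamma != 0.
Proof.
move=> cV ga0 r xp yp xy0; apply: contraTneq xy0 => phi0.
have e0 := root_vector_eq0 lieb ga0 r.
rewrite e0 orbb negbK; apply: contraT => y0.
have x0 : x != 0 by rewrite e0.
have xv : br x (orbit_base br phi) = 0 *: orbit_base br phi.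
  by have [-> _] := br_orbit_base phi r; rewrite phi0 !scale0r.
have Vx (t : R) : stabilizer G (orbit_base br phi) (lexp G (t *: x)).
  by rewrite /stabilizer /= (Ad_lexp_eigen G t xv) mul0r expR0 scale1r.
pose c := killing br x x * hform br gamma gamma.
have c0 : 0 < c.
  rewrite mulr_gt0 ?(hform_gt0 lieb cartan h0k) //.
  by have := killing_part cartan (s := true) xp x0; rewrite mul1r.
have sE := br_root_vector_coroot lieb cartan h0k csa r.
have xs : br x (br x y) = c *: y.
  rewrite sE (brZr lieb) (brC lieb x).
  have [-> _] := r (hcoord br gamma).
  by rewrite -(hformE lieb cartan h0k) scalerN scaleNr opprK scalerA.
(* [x, y] and [x, [x, y]] = c y give the eigenvector mu y + [x, y] of ad x. *)
pose mu := Num.sqrt c.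
have mu0 : 0 < mu by rewrite sqrtr_gt0.
have xw : br x (mu *: y + br x y) = mu *: (mu *: y + br x y).
  rewrite (brDr lieb) (brZr lieb) xs scalerDr scalerA -expr2 sqr_sqrtr ?ltW //.
  by rewrite addrC.
have /eqP := compact_lexp_line_eigen cV Vx xw mu0.
rewrite addr_eq0 => /eqP w0.
have yk : mu *: y \in k.
  rewrite w0 rpredN; exact: (mem_part_br lieb cartan (s := true) (t := true) xp yp).
have /eqP := part_disjoint cartan yk (rpredZ mu yp).
by rewrite scaler_eq0 gt_eqF //= (negPf y0).
Qed.

Section ComplexStructure.
Context {l : nat} (gamma : 'I_l -> hdual h0) (G : lieGroup br) (phi : hdual h0).
Context (J : 'rV[R]_n -> 'rV[R]_n -> 'rV[R]_n).
Context (canJ : canonical_acs G k gamma phi J).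

(** J multiplies x + i y by i times the sign of alpha. *)
Lemma canonical_acs_root_vector alpha x y : positive_root br gamma alpha ->
  hform br phi alpha != 0 -> root_vector br alpha x y ->
  J (orbit_base br phi) (br x (orbit_base br phi)) =
    br (- root_sign br k alpha *: y) (orbit_base br phi).
Proof.
move=> pos ne0 r; case: canJ => _ /(_ _ pos ne0 x) ->; last first.
  exact: root_vector_real_root_space lieb _ _ _ r.
rewrite (brC lieb (orbit_base br phi) x); have [-> _] := br_orbit_base phi r.
by rewrite scalerN scalerA divfK // scaleNr.
Qed.

(** Evaluate the Nijenhuis tensor on the real parts x and a: the signs 1, 1, -1
    make its value - 2 [P, v], where P + i Q is the bracket of the two root
    vectors, and v does not commute with P since (phi, alpha + beta) <> 0. *)
Lemma not_integrable_of_roots alpha beta x y a b :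
  positive_root br gamma alpha -> positive_root br gamma beta ->
  positive_root br gamma (alpha + beta) ->
  0 < hform br phi alpha -> 0 < hform br phi beta ->
  root_sign br k alpha = 1 -> root_sign br k beta = 1 ->
  root_sign br k (alpha + beta) = -1 ->
  root_vector br alpha x y -> root_vector br beta a b ->
  (br x a - br y b != 0) || (br x b + br y a != 0) ->
  ~ integrable_acs G (orbit_base br phi) J.
Proof.
move=> pa pb pab fa fb sa sb sab ra rb nz int.
have rab := br_root_vectors lieb ra rb.
set P := br x a - br y b in nz rab; set Q := br x b + br y a in nz rab.
have fab : 0 < hform br phi (alpha + beta).
  by rewrite (hformDr lieb cartan h0k) addr_gt0.
set v := orbit_base br phi in int *.
have [invJ _] := canJ; rewrite -/v in invJ.
have Jx : Jfund lieb invJ x = br (- y) v.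
  by rewrite JfundE (canonical_acs_root_vector pa _ ra) ?gt_eqF // sa scaleN1r.
have Ja : Jfund lieb invJ a = br (- b) v.
  by rewrite JfundE (canonical_acs_root_vector pb _ rb) ?gt_eqF // sb scaleN1r.
have JQ : Jfund lieb invJ Q = - br P v.
  rewrite JfundE (canonical_acs_root_vector pab _ (root_vector_rot lieb rab)) ?gt_eqF //.
  by rewrite sab opprK scale1r (brNl lieb).
have := nijenhuis_br Jx Ja.
rewrite (int _ _ (vector_field_br lieb G v x) (vector_field_br lieb G v a) v (orbit_refl G v)).
have -> : br (- y) a + br x (- b) = - Q.
  by rewrite (brNl lieb) (brNr lieb) -opprD addrC.
have -> : br (- y) (- b) = br y b by rewrite (brNl lieb) (brNr lieb) opprK.
rewrite (linearN (Jfund lieb invJ)) JQ opprK.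
have -> : br (br y b) v - br P v - br (br x a) v = - (br P v + br P v).
  rewrite /P !(brBl lieb); apply/rowP => i; rewrite !mxE; ring.
move=> /esym/eqP; rewrite oppr_eq0 -mulr2n -scaler_nat scaler_eq0 pnatr_eq0 /=.
have [-> _] := br_orbit_base phi rab.
rewrite scaler_eq0 gt_eqF //= => Q0.
have ab0 : alpha + beta != 0.
  by apply: contraTneq fab => ->; rewrite (hformC lieb) (hform0l lieb cartan h0k) ltxx.
by move: nz; rewrite (root_vector_eq0 lieb ab0 rab) Q0.
Qed.

End ComplexStructure.
End CanonicalStructure.

(** * Diagrams with two painted nodes *)

Section PaintedPath.
Context {R : realType} {D : voganDiagram} {n : nat}.
Context {br : 'rV[R]_n -> 'rV[R]_n -> 'rV[R]_n} {k p h0 : {vspace 'rV[R]_n}}.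
Context {gamma : 'I_(vrank D) -> hdual h0}.
Context (hreal : vogan_realization br k p gamma).
Implicit Types (i j m : 'I_(vrank D)) (s : seq 'I_(vrank D)).

Let lieb := vr_bracket hreal.
Let cartan := vr_cartan_decomposition hreal.
Let h0k := vr_h0_sub hreal.
Let csa := vr_cartan hreal.

Definition root_sum s : hdual h0 := \sum_(m <- s) gamma m.

Lemma root_sum_rcons s m : root_sum (rcons s m) = gamma m + root_sum s.
Proof. by rewrite /root_sum big_rcons /= addrC. Qed.

Lemma nonneg_combD a b : nonneg_comb gamma a -> nonneg_comb gamma b ->
  nonneg_comb gamma (a + b).
Proof.
move=> [c ->] [d ->]; exists (fun i => c i + d i)%N.
by rewrite -big_split; apply: eq_bigr => i _; rewrite mulrnDr.
Qed.

Lemma simple_root_is_root i : is_root br (gamma i).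
Proof. by case: (vr_base hreal). Qed.

Lemma simple_root_neq0 i : gamma i != 0.
Proof. by case: (simple_root_is_root i). Qed.

Lemma simple_root_positive i : positive_root br gamma (gamma i).
Proof.
split; first exact: simple_root_is_root.
exists (fun j => (j == i)%N : nat); rewrite (bigD1 i) //= eqxx mulr1n.
by rewrite big1 ?addr0 // => j /negPf ->.
Qed.

Lemma nonneg_comb_root_sum s : nonneg_comb gamma (root_sum s).
Proof.
rewrite /root_sum; elim: s => [|m s IH].
  by exists (fun=> 0%N); rewrite big_nil big1.
by rewrite big_cons; apply: nonneg_combD => //; case: (simple_root_positive m).
Qed.

Lemma hform_simple_gt0 i : 0 < hform br (gamma i) (gamma i).
Proof. exact: hform_gt0 lieb cartan h0k _ (simple_root_neq0 i). Qed.

Lemma hform_simple_le0 i j : i != j -> hform br (gamma i) (gamma j) <= 0.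
Proof.
move=> ij; have := vr_cartan_matrix hreal i j.
have := classical_cartan_le0 (vtype D) (vrank D) ij.
rewrite -(lerz0 R) => + e; rewrite -e => {e}.
by rewrite pmulr_lle0 ?invr_gt0 ?hform_simple_gt0 // pmulr_rle0.
Qed.

Lemma hform_simple_lt0 i j : i != j -> diagram_adj (vtype D) i j ->
  hform br (gamma i) (gamma j) < 0.
Proof.
move=> ij /(classical_cartan_lt0 ij); have := vr_cartan_matrix hreal i j.
rewrite -(ltrz0 R) => <-.
by rewrite pmulr_llt0 ?invr_gt0 ?hform_simple_gt0 // pmulr_rlt0.
Qed.

Lemma simple_root_vector i : exists x y, [/\ root_vector br (gamma i) x y,
  x \in part k p (i \in painted D), y \in part k p (i \in painted D) &
  (x != 0) || (y != 0)].
Proof.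
apply: root_space_vector lieb _ _ (simple_root_is_root i) _ => z rz.
have [ip|ip] := boolP (i \in painted D).
  exact: (vr_painted hreal ip rz).
exact: (vr_unpainted hreal ip rz).
Qed.

(** m is distinct from all nodes of the path, hence every term is non-positive,
    and it is adjacent to the last one, whose term is negative. *)
Lemma hform_path_lt0 i s m : path (@diagram_adj (vtype D) (vrank D)) i (rcons s m) ->
  uniq (i :: rcons s m) -> hform br (root_sum (i :: s)) (gamma m) < 0.
Proof.
rewrite rcons_path -rcons_cons rcons_uniq => /andP[_ adj] /andP[mt _].
have hS u : hform br (root_sum u) (gamma m) =
    \sum_(q <- u) hform br (gamma q) (gamma m).
  rewrite /root_sum; elim: u => [|q u IH].
    by rewrite !big_nil (hform0l lieb cartan h0k).
  by rewrite !big_cons (hformDl lieb cartan h0k) IH.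
move: mt; rewrite hS lastI mem_rcons inE negb_or => /andP[ml mt].
rewrite big_rcons /= ltr_wnDl //; last by rewrite hform_simple_lt0 // eq_sym.
rewrite big_seq; apply: sumr_le0 => q qt; apply: hform_simple_le0.
by apply: contraNneq mt => <-.
Qed.

(** Bracketing with root vectors in k keeps the vector in p, and it stays
    non-zero by the negativity of [hform_path_lt0]. *)
Lemma path_root_vector i s : i \in painted D ->
  path (@diagram_adj (vtype D) (vrank D)) i s -> uniq (i :: s) ->
  all (fun m => m \notin painted D) s ->
  exists x y, [/\ root_vector br (root_sum (i :: s)) x y, x \in p, y \in p &
    (x != 0) || (y != 0)].
Proof.
move=> iA; elim/last_ind: s => [_ _ _|s m IH sp su].
  have [x [y [r]]] := simple_root_vector i; rewrite iA => xp yp xy0.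
  by exists x, y; rewrite /root_sum big_seq1.
rewrite all_rcons => /andP[mA sA].
have sp' : path (@diagram_adj (vtype D) (vrank D)) i s.
  by move: sp; rewrite rcons_path => /andP[].
have su' : uniq (i :: s) by move: su; rewrite -rcons_cons rcons_uniq => /andP[].
have [a [b [ra ap bp ab0]]] := IH sp' su' sA.
have [x [y [rx]]] := simple_root_vector m; rewrite (negPf mA) => xk yk xy0.
exists (br x a - br y b), (br x b + br y a); split.
- by rewrite -rcons_cons root_sum_rcons; exact: br_root_vectors.
- by rewrite rpredB //; apply: (mem_part_br lieb cartan (s := false) (t := true)).
- by rewrite rpredD //; apply: (mem_part_br lieb cartan (s := false) (t := true)).
- apply: (br_root_vectors_neq0 lieb cartan h0k csa (s := false) (t := true)
    rx xk yk xy0 ra ap bp ab0).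
  exact: hform_path_lt0.
Qed.

(** Dominance gives (phi, gamma_i) >= 0 and compactness excludes 0. *)
Lemma hform_painted_gt0 (G : lieGroup br) phi i :
  dominant br gamma phi -> compact (stabilizer G (orbit_base br phi)) ->
  i \in painted D -> 0 < hform br phi (gamma i).
Proof.
move=> dom cV ip; have [x [y [r]]] := simple_root_vector i; rewrite ip => xp yp xy0.
rewrite lt_def (dom _ (simple_root_positive i)) andbT.
exact: (compact_stabilizer_noncompact lieb cartan h0k csa cV (simple_root_neq0 i)
  r xp yp xy0).
Qed.

End PaintedPath.

Theorem theorem8p7 (R : realType) (D : voganDiagram) (n : nat)
    (br : 'rV[R]_n -> 'rV[R]_n -> 'rV[R]_n) (k p h0 : {vspace 'rV[R]_n})
    (gamma : 'I_(vrank D) -> hdual h0)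
    (hreal : vogan_realization br k p gamma)
    (hpainted : (2 <= #|painted D|)%N)
    (G : lieGroup br) (phi : hdual h0)
    (hphi : dominant br gamma phi)
    (hcompact : compact (stabilizer G (orbit_base br phi)))
    (J : 'rV[R]_n -> 'rV[R]_n -> 'rV[R]_n)
    (hJ : canonical_acs G k gamma phi J) :
  ~ integrable_acs G (orbit_base br phi) J.
Proof.
have lieb := vr_bracket hreal; have cartan := vr_cartan_decomposition hreal.
have h0k := vr_h0_sub hreal; have csa := vr_cartan hreal.
have [i [s [j [sp su iA jA sA]]]] := painted_path (vrankP D) hpainted.
have sp' : path (@diagram_adj (vtype D) (vrank D)) i s.
  by move: sp; rewrite rcons_path => /andP[].
have su' : uniq (i :: s) by move: su; rewrite -rcons_cons rcons_uniq => /andP[].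
set beta := root_sum (gamma := gamma) (i :: s).
have [a [b [ra ap bp ab0]]] := path_root_vector hreal iA sp' su' sA.
have [x [y [rx]]] := simple_root_vector hreal j; rewrite jA => xp yp xy0.
have nz := br_root_vectors_neq0 lieb cartan h0k csa (s := true) (t := true)
  rx xp yp xy0 ra ap bp ab0 (hform_path_lt0 hreal sp su).
have rab := br_root_vectors lieb rx ra.
have f_gt0 m : m \in painted D -> 0 < hform br phi (gamma m).
  exact: hform_painted_gt0 hreal _ _ _ hphi hcompact.
have fj := f_gt0 j jA.
have fb : 0 < hform br phi beta.
  rewrite /beta /root_sum big_cons (hformDr lieb cartan h0k) ltr_wpDr ?f_gt0 //.
  apply: (big_ind (fun psi => 0 <= hform br phi psi)).
  - by rewrite (hformC lieb) (hform0l lieb cartan h0k).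
  - by move=> c d c0 d0; rewrite (hformDr lieb cartan h0k) addr_ge0.
  - by move=> m _; exact: hphi _ (simple_root_positive hreal m).
have fjb : 0 < hform br phi (gamma j + beta).
  by rewrite (hformDr lieb cartan h0k) addr_gt0.
have f_neq0 c : 0 < hform br phi c -> c != 0.
  move=> fc; apply: contraTneq fc => ->.
  by rewrite (hformC lieb) (hform0l lieb cartan h0k) ltxx.
have Pk : br x a - br y b \in k.
  by rewrite rpredB //; apply: (mem_part_br lieb cartan (s := true) (t := true)).
have Qk : br x b + br y a \in k.
  by rewrite rpredD //; apply: (mem_part_br lieb cartan (s := true) (t := true)).
have posj := simple_root_positive hreal j.
have posb : positive_root br gamma beta :=
  conj (root_vector_is_root lieb (f_neq0 _ fb) ra ab0) (nonneg_comb_root_sum hreal _).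
have posjb : positive_root br gamma (gamma j + beta) :=
  conj (root_vector_is_root lieb (f_neq0 _ fjb) rab nz) (nonneg_combD posj.2 posb.2).
have signj := root_sign_part lieb cartan h0k csa (s := true) (f_neq0 _ fj) rx xp yp xy0.
have signb := root_sign_part lieb cartan h0k csa (s := true) (f_neq0 _ fb) ra ap bp ab0.
have signjb := root_sign_part lieb cartan h0k csa (s := false) (f_neq0 _ fjb) rab Pk Qk nz.
exact: (not_integrable_of_roots lieb cartan h0k hJ posj posb posjb fj fb
  signj signb signjb rx ra nz).
Qed.
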